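(* Consider minimizing $f(x)=\mathbb{E}_{z\sim P}[\tilde f(x,z)]$ over $\mathcal{K}\subseteq\mathbb{R}^d$, where $\mathcal{K}$ is convex and compact with diameter $D=\sup_{x,y\in\mathcal{K}}\|x-y\|$, and where for all $z\in\mathbb{R}^q$ the function $\tilde f(\cdot,z)$ is convex and $L$-smooth on $\mathcal{K}$, $\nabla\tilde f(x,z)$ is an unbiased estimate of $\nabla f(x)$ with variance bounded by $\sigma^2$, and $\|\nabla\tilde f(x,z)\|_\infty\le G_\infty$ for all $x\in\mathcal{K}$, $z\in\mathbb{R}^q$. Run the Quantized Frank-Wolfe (QFW) algorithm described in the context with: $p_i=2^{i-1}$; $S_{i,1}=\frac{\sigma^2p_i^2}{ML^2D^2}$; $S_{i,k}=p_i/M$ for $i\ge1,k\ge2$; $\eta_{i,k}=2/(p_i+k)$; and the $s$-Partition Encoding Scheme with levels $s_{1,i,1}=\sqrt{dp_i^2/M}$, $s_{2,i,1}=\sqrt{dp_i^2}$, and $s_{1,i,k}=\sqrt{dp_i/M}$, $s_{2,i,k}=\sqrt{dp_i}$ for $k\ge2$. Then, to obtain an $\epsilon$-suboptimal solution (i.e. $\mathbb{E}[f(x_{T+1})]-\min_{\mathcal{K}}f\le\epsilon$), it suffices to run at most $T=\mathcal{O}(1/\epsilon)$ iterations, and the SFO complexity per worker is $\mathcal{O}(1/(M\epsilon^2))$.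
   Context: $\|\cdot\|$ is the Euclidean norm; gradients are with respect to $x$. There are $M$ workers and a master. A function is $L$-smooth on $\mathcal{K}$ if its gradient is $L$-Lipschitz on $\mathcal{K}$. Bounded variance means $\mathbb{E}_{z\sim P}\|\nabla\tilde f(x,z)-\nabla f(x)\|^2\le\sigma^2$ for $x\in\mathcal{K}$. The $\mathcal{O}(\cdot)$ is for small $\epsilon$, with hidden constants depending only on $L,D,G_\infty,\sigma$. The SFO complexity per worker is the number of stochastic gradients computed by one worker, where round $(i,k)$ costs (up to a constant factor) the nominal sample size $S_{i,k}$. $s$-Partition Encoding Scheme: for $g\in\mathbb{R}^d$ and each coordinate $i$, find $l_i\in\{0,\dots,s-1\}$ with $|g_i|/\|g\|_\infty\in[l_i/s,(l_i+1)/s]$ and let $b_i=l_i/s$ with probability $1-\frac{|g_i|}{\|g\|_\infty}s+l_i$, and $b_i=(l_i+1)/s$ with probability $\frac{|g_i|}{\|g\|_\infty}s-l_i$. The transmitted data are $\mathrm{sign}(g_i)b_i$ and $\|g\|_\infty$; the decoded vector $\phi'(g)$ has coordinates $\mathrm{sign}(g_i)b_i\|g\|_\infty$ (and $\phi'(0)=0$). QFW: starting from $x_1\in\mathcal{K}$, rounds $t=1,\dots,T$ are grouped in consecutive periods of lengths $p_1,p_2,\dots$; round $t$ corresponds to $(i,k)$ with $t=\sum_{j=1}^{i-1}p_j+k$, $1\le k\le p_i$, and $x_{i,k}=x_t$, $\eta_{i,k}=\eta_t$. In round $(i,k)$ each worker $m$ draws a collection $\mathcal{S}_{i,k}^m$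 of $S_{i,k}$ stochastic functions $\tilde f(\cdot,z)$ with i.i.d. $z\sim P$. Writing $f_{\mathcal{S}}$ for the average of the functions in $\mathcal{S}$, the worker computes $g_{i,1}^m=\nabla f_{\mathcal{S}_{i,1}^m}(x_t)$ if $k=1$, and $g_{i,k}^m=\nabla f_{\mathcal{S}_{i,k}^m}(x_t)-\nabla f_{\mathcal{S}_{i,k}^m}(x_{t-1})$ if $k\ge2$, and sends it encoded with level $s_{1,i,k}$. The master decodes these to $\Phi_{1,i,k}'(g_{i,k}^m)$, forms $\tilde g_{i,k}=\frac1M\sum_{m=1}^M\Phi_{1,i,k}'(g_{i,k}^m)$, and broadcasts it encoded with level $s_{2,i,k}$; workers decode it to $\Phi_{2,i,k}'(\tilde g_{i,k})$ and set $\bar g_{i,1}=\Phi_{2,i,1}'(\tilde g_{i,1})$ if $k=1$, $\bar g_{i,k}=\Phi_{2,i,k}'(\tilde g_{i,k})+\bar g_{i,k-1}$ if $k\ge2$. Then $v_{i,k}\in\arg\min_{v\in\mathcal{K}}\langle v,\bar g_{i,k}\rangle$ and $x_{t+1}=x_t+\eta_{i,k}(v_{i,k}-x_t)$. All random choices are independent across coordinates, workers and rounds. In the algorithm, sample sizes and levels that are not positive integers are rounded up to the next positive integer. *)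

(* Defs.v *)
From HB Require Import structures.
From mathcomp Require Export all_boot all_order all_algebra.
From mathcomp Require Export all_classical all_reals all_analysis.
Export Order.TTheory GRing.Theory Num.Theory.
Export numFieldNormedType.Exports.

#[export] Set Implicit Arguments.
#[export] Unset Strict Implicit.
#[export] Unset Printing Implicit Defensive.

Local Open Scope classical_set_scope.
Local Open Scope ring_scope.

Section Euclidean.
Context {R : realType} {d : nat}.
Implicit Types (u v x y : 'rV[R]_d) (K : set 'rV[R]_d) (f : 'rV[R]_d -> R).

(* The library norm `|u| on 'rV[R]_d is the max norm: it is used below for the
   infinity norm, and [enorm] for the Euclidean norm. *)
Definition dot u v : R := \sum_c u 0 c * v 0 c.
Definition enorm u : R := Num.sqrt (dot u u).

Definition diameter K : R :=
  sup [set enorm (xy.1 - xy.2) | xy in K `*` K].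

Definition grad f x : 'rV[R]_d := \row_c 'D_(delta_mx 0 c) f x.

Definition smooth_on K (L : R) f : Prop :=
  (forall x, K x -> differentiable f x) /\
  (forall x y, K x -> K y ->
     enorm (grad f x - grad f y) <= L * enorm (x - y)).

Definition argmin K f : set 'rV[R]_d :=
  [set x | K x /\ forall y, K y -> f x <= f y].

End Euclidean.

Section Problem.
Context {R : realType} {d q : nat}.

(* Points z of R^q are q-tuples, which carry the product sigma-algebra.
   [f] is only tied to E_z[ft x z] on K; off K it is an arbitrary extension,
   just as [ft] itself is unconstrained off K.  Integrability and
   measurability are what the expectations over z presuppose. *)
Record stochastic_problem (K : set 'rV[R]_d) (P : probability (q.-tuple R) R)
    (ft : 'rV[R]_d -> q.-tuple R -> R) (f : 'rV[R]_d -> R)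
    (L D Ginf sigma : R) : Prop := StochasticProblem {
  domain_convex : convex_set K;
  domain_compact : compact K;
  domain_diameter : D = diameter K;
  ft_integrable : forall x, K x -> P.-integrable setT (EFin \o ft x);
  f_expectation : forall x, K x -> ('E_P[ft x] = (f x)%:E)%E;
  ft_convex : forall z, convex_function K (ft^~ z);
  ft_smooth : forall z, smooth_on K L (ft^~ z);
  grad_measurable : forall x c, K x ->
    measurable_fun setT (fun z => grad (ft^~ z) x 0 c);
  f_differentiable : forall x, K x -> differentiable f x;
  grad_unbiased : forall x c, K x ->
    ('E_P[fun z => grad (ft^~ z) x 0%R c] = (grad f x 0%R c)%:E)%E;
  grad_variance : forall x, K x ->
    ('E_P[fun z => (enorm (grad (ft^~ z) x - grad f x) ^+ 2)%R]
       <= (sigma ^+ 2)%:E)%E;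
  grad_bounded : forall x z, K x -> `|grad (ft^~ z) x| <= Ginf }.

End Problem.

Section Partition_encoding.
Context {R : realType}.

(* A ratio r in [0, 1] lies in [l/s, (l+1)/s] with l < s; the [minn] only
   matters at r = 1, where l = s - 1.  When u is uniform on [0, 1], the value is
   (l+1)/s with probability r s - l and l/s with probability 1 - r s + l. *)
Definition partition_round (s : nat) (u r : R) : R :=
  let l := minn (Num.truncn (r * s%:R)) s.-1 in
  (if u < r * s%:R - l%:R then l.+1 else l)%:R / s%:R.

(* Encoding followed by decoding.  At g = 0 this is 0 since Num.sg 0 = 0. *)
Definition quantize (d s : nat) (u : 'I_d -> R) (g : 'rV[R]_d) : 'rV[R]_d :=
  \row_c (Num.sg (g 0 c) * partition_round s (u c) (`|g 0 c| / `|g|) * `|g|).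

(* For x >= 0: x itself if it is a positive integer, and otherwise the next
   positive integer. *)
Definition roundup (x : R) : nat := maxn 1 `|Num.ceil x|.

End Partition_encoding.

(* The elementary random choices: the j-th sample of worker m in round t (one
   infinite i.i.d. sequence, of which a round uses an initial segment), and the
   uniform seed used for coordinate c in round t by the encoder of worker m,
   respectively by the encoder of the master. *)
Definition draw (M d : nat) : Type :=
  (nat * 'I_M * nat + nat * 'I_M * 'I_d + nat * 'I_d)%type.

Definition draw_round (M d : nat) (e : draw M d) : nat :=
  match e with
  | inl (inl (t, _, _)) => t
  | inl (inr (t, _, _)) => t
  | inr (t, _) => t
  end.

Section Randomness.
Context {dO : measure_display} {Omega : measurableType dO} {R : realType}.
Variable Pr : probability Omega R.

Definition mutually_independent (I : eqType) (F : I -> set (set Omega)) : Prop :=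
  forall (s : seq I) (A : I -> set Omega), uniq s ->
    (forall i, i \in s -> F i (A i)) ->
    (Pr (\bigcap_(i in [set` s]) A i) = \prod_(i <- s) Pr (A i))%E.

Context {M d q : nat}.
Variables (z : nat -> 'I_M -> nat -> {RV Pr >-> q.-tuple R})
  (u1 : nat -> 'I_M -> 'I_d -> {RV Pr >-> R})
  (u2 : nat -> 'I_d -> {RV Pr >-> R}).

Definition draw_events (e : draw M d) : set (set Omega) :=
  match e with
  | inl (inl (t, m, j)) => preimage_set_system setT (z t m j) measurable
  | inl (inr (t, m, c)) => preimage_set_system setT (u1 t m c) measurable
  | inr (t, c) => preimage_set_system setT (u2 t c) measurable
  end.

(* The sigma-algebra generated by all random choices of rounds <= t. *)
Definition history (t : nat) : set (set Omega) :=
  <<s \bigcup_(e in [set e | (draw_round e <= t)%N]) draw_events e >>.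

Record independent_draws (P : probability (q.-tuple R) R) : Prop :=
  IndependentDraws {
  sample_law : forall t m j A, measurable A -> distribution Pr (z t m j) A = P A;
  worker_seed_law : forall t m c (A : set R), measurable A ->
    distribution Pr (u1 t m c) A = uniform_prob (@ltr01 R) A;
  master_seed_law : forall t c (A : set R), measurable A ->
    distribution Pr (u2 t c) A = uniform_prob (@ltr01 R) A;
  draws_independent : mutually_independent draw_events }.

End Randomness.

Definition round_index (p : nat -> nat) (i k : nat) : nat :=
  (\sum_(1 <= j < i) p j + k)%N.

Section QFW.
Context {R : realType} {d q M : nat}.
Variable ft : 'rV[R]_d -> q.-tuple R -> R.

Definition batch_fun (n : nat) (zs : nat -> q.-tuple R) : 'rV[R]_d -> R :=
  fun y => n%:R^-1 * \sum_(j < n) ft y (zs j).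

(* [x] is the current iterate and [x'] the previous one. *)
Definition worker_gradient (n : nat) (zs : nat -> q.-tuple R) (k : nat)
    (x x' : 'rV[R]_d) : 'rV[R]_d :=
  if k == 1%N then grad (batch_fun n zs) x
  else grad (batch_fun n zs) x - grad (batch_fun n zs) x'.

Definition master_gradient (n s : nat) (zs : 'I_M -> nat -> q.-tuple R)
    (u : 'I_M -> 'I_d -> R) (k : nat) (x x' : 'rV[R]_d) : 'rV[R]_d :=
  M%:R^-1 *: \sum_(m < M) quantize s (u m) (worker_gradient n (zs m) k x x').

(* Processes are indexed by the global round t >= 1; sample sizes, step sizes
   and levels by (i, k).  [gbar t] and [v t] are gbar_{i,k} and v_{i,k}; for
   k >= 2 the previous pair (i, k - 1) is round t - 1.  The minimizer v_{i,k} may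
   be any one, chosen with knowledge of the rounds <= t only. *)
Record qfw_run (dO : measure_display) (Omega : measurableType dO)
    (Pr : probability Omega R) (K : set 'rV[R]_d)
    (p : nat -> nat) (S eta s1 s2 : nat -> nat -> R)
    (z : nat -> 'I_M -> nat -> {RV Pr >-> q.-tuple R})
    (u1 : nat -> 'I_M -> 'I_d -> {RV Pr >-> R})
    (u2 : nat -> 'I_d -> {RV Pr >-> R})
    (x gbar v : nat -> Omega -> 'rV[R]_d) : Prop := QFWRun {
  run_init : exists2 x1, K x1 & forall w, x 1%N w = x1;
  run_estimate : forall i k, (1 <= i)%N -> (1 <= k <= p i)%N ->
    let t := round_index p i k in
    forall w,
      let gtilde := master_gradient (roundup (S i k)) (roundup (s1 i k))
        (fun m j => z t m j w) (fun m c => u1 t m c w) k (x t w) (x t.-1 w) in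
      let delta := quantize (roundup (s2 i k)) (fun c => u2 t c w) gtilde in
      gbar t w = if k == 1%N then delta else delta + gbar t.-1 w;
  run_oracle : forall i k, (1 <= i)%N -> (1 <= k <= p i)%N ->
    let t := round_index p i k in
    forall w, argmin K (fun y => dot y (gbar t w)) (v t w);
  run_adapted : forall i k, (1 <= i)%N -> (1 <= k <= p i)%N ->
    let t := round_index p i k in
    forall c (B : set R), measurable B ->
      history z u1 u2 t ((fun w => v t w 0 c) @^-1` B);
  run_step : forall i k, (1 <= i)%N -> (1 <= k <= p i)%N ->
    let t := round_index p i k in
    forall w, x t.+1 w = x t w + eta i k *: (v t w - x t w) }.

(* Stochastic gradients computed by one worker in the first T rounds, counted
   with nominal sample sizes: a round with k >= 2 evaluates two gradients for
   each sample. *)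
Definition sfo_complexity (p : nat -> nat) (S : nat -> nat -> R) (T : nat) : R :=
  \sum_(1 <= i < T.+1) \sum_(1 <= k < (p i).+1 | (round_index p i k <= T)%N)
    (if k == 1%N then 1 else 2) * S i k.

Definition suboptimal (dO : measure_display) (Omega : measurableType dO)
    (Pr : probability Omega R) (K : set 'rV[R]_d) (f : 'rV[R]_d -> R)
    (eps : R) (X : Omega -> 'rV[R]_d) : Prop :=
  exists2 xmin, argmin K f xmin &
    ('E_Pr[fun w => f (X w)] - (f xmin)%:E <= eps%:E)%E.

End QFW.

Section Schedule.
Context {R : realType}.
Variables (d M : nat) (L D sigma : R).

Definition period (i : nat) : nat := (2 ^ i.-1)%N.

Definition sample_size (i k : nat) : R :=
  if k == 1%N then
    sigma ^+ 2 * (period i)%:R ^+ 2 / (M%:R * L ^+ 2 * D ^+ 2)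
  else (period i)%:R / M%:R.

Definition step_size (i k : nat) : R := 2 / ((period i)%:R + k%:R).

Definition worker_level (i k : nat) : R :=
  if k == 1%N then Num.sqrt (d%:R * (period i)%:R ^+ 2 / M%:R)
  else Num.sqrt (d%:R * (period i)%:R / M%:R).

Definition master_level (i k : nat) : R :=
  if k == 1%N then Num.sqrt (d%:R * (period i)%:R ^+ 2)
  else Num.sqrt (d%:R * (period i)%:R).

End Schedule.

(* Main.v *)
From mathcomp Require Import finmap ring lra measurable_realfun.
Require Import Defs.

(** Inside period i, of length p = 2^(i-1), the estimate gbar is refreshed by
    differences of gradients, so its error gbar_t - grad f(x_t) is a sum of
    contributions of three kinds: the sampling noise of each stochastic
    function, the rounding of each worker, and the rounding of the master.
    Each contribution is caused by one fresh random draw and has mean zero when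
    all other draws are held fixed.  Contributions of different draws are
    therefore orthogonal in L^2, and second moments add up
    ([round_error_sqr]).

    In the first round of the period the batch is large enough for the sampling
    noise to contribute at most (L D)^2 / p^2, and each of the two encodings
    contributes at most Ginf^2 / p^2.  In a later round the iterate has moved
    by at most 2 D / p, so by smoothness every vector that is averaged or
    encoded has norm at most 2 L D / p, and the round contributes
    O((L D)^2 / p^3).  There are fewer than p such rounds, hence the error has
    second moment at most
    error_bound / p^2 throughout the period ([estimate_error_sqr]).  Neither
    the dimension nor the number of workers enters, because the levels grow
    like sqrt d while the rounding error of a vector g is at most |g| / s in
    each coordinate.

    For the gap h_t = f(x_t) - min f, smoothness, convexity and the choice of
    the vertex v_t give
      h_(t+1) <= (1 - eta_t) h_t + eta_t D |e_t| + L (eta_t D)^2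
    ([frank_wolfe_step]).  In round t = (i, k) one has t + 1 = p + k <= 2 p and
    step size 2 / (t + 1), so the last two terms have mean at most gap_rate / (t + 1)^2,
    and induction gives E h_(t+1) <= gap_rate / (t + 1) ([mean_gap_le]).
    Thus T = floor (gap_rate / eps) rounds suffice.  A period costs O(p^2 / M)
    stochastic gradients per worker, and the squares of the lengths of the
    periods that begin by round T form a geometric sum bounded by 4 T^2
    ([sfo_complexity_le]).

    The probabilistic core is the passage from independence, which is given for
    finite families of events of single draws, to conditional means at random
    points.  For a set E of draws, Dynkin's theorem makes a draw outside E
    independent of the sigma-algebra generated by E ([independent_of_family]);
    then the joint law of the two is a product and Fubini's theorem allows the
    fresh draw to be integrated out with everything known from E held fixed
    ([freezing_le], [freezing_eq0]).  The joint measurability that Fubini's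
    theorem needs holds because sample gradients are Lipschitz in the point
    and measurable in the sample ([measurable_lipschitz_comp]). *)

Local Open Scope classical_set_scope.
Local Open Scope ring_scope.

(** * Euclidean geometry of row vectors *)

Lemma eqr_le (R : numDomainType) (a b : R) : a = b -> a <= b.
Proof. by move->. Qed.

Section DotProduct.
Context {R : realType} {d : nat}.
Implicit Types (u v w : 'rV[R]_d) (a : R).

Lemma dotC u v : dot u v = dot v u.
Proof. by apply: eq_bigr => c _; rewrite mulrC. Qed.

Lemma dotDl u v w : dot (u + v) w = dot u w + dot v w.
Proof. by rewrite /dot -big_split; apply: eq_bigr => c _; rewrite mxE mulrDl. Qed.

Lemma dotZl a u v : dot (a *: u) v = a * dot u v.
Proof. by rewrite /dot mulr_sumr; apply: eq_bigr => c _; rewrite mxE mulrA. Qed.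

Lemma dotBl u v w : dot (u - v) w = dot u w - dot v w.
Proof. by rewrite -scaleN1r dotDl dotZl mulN1r. Qed.

Lemma dotZr a u v : dot u (a *: v) = a * dot u v.
Proof. by rewrite dotC dotZl dotC. Qed.

Lemma dotBr u v w : dot u (v - w) = dot u v - dot u w.
Proof. by rewrite dotC dotBl !(dotC _ u). Qed.

Lemma dot0l v : dot 0 v = 0.
Proof. by rewrite -(scale0r 0) dotZl mul0r. Qed.

Lemma dot_ge0 u : 0 <= dot u u.
Proof. by apply: sumr_ge0 => c _; rewrite -expr2 sqr_ge0. Qed.

Lemma enorm_ge0 u : 0 <= enorm u.
Proof. exact: sqrtr_ge0. Qed.

Lemma enorm_sqr u : enorm u ^+ 2 = dot u u.
Proof. by rewrite sqr_sqrtr ?dot_ge0. Qed.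

Lemma enormZ a u : enorm (a *: u) = `|a| * enorm u.
Proof. by rewrite /enorm dotZl dotZr mulrA -expr2 sqrtrM ?sqr_ge0// sqrtr_sqr. Qed.

Lemma enorm_eq0 u : enorm u = 0 -> u = 0.
Proof.
move=> /(congr1 (fun x => x ^+ 2)); rewrite enorm_sqr expr0n /= => /eqP.
rewrite psumr_eq0 => [/allP u0|c _]; last by rewrite -expr2 sqr_ge0.
apply/rowP => c; have := u0 c; rewrite mem_index_enum mxE => /(_ isT) /=.
by rewrite mulf_eq0 orbb => /eqP.
Qed.

(** Expand the square of the vector |v| u - |u| v; its nonnegativity is the
    claim multiplied by 2 |u| |v|. *)
Lemma cauchy_schwarz u v : dot u v <= enorm u * enorm v.
Proof.
have [/enorm_eq0->|u0] := eqVneq (enorm u) 0.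
  by rewrite dot0l mulr_ge0 ?enorm_ge0.
have [/enorm_eq0->|v0] := eqVneq (enorm v) 0.
  by rewrite dotC dot0l mulr_ge0 ?enorm_ge0.
have ugt : 0 < enorm u by rewrite lt0r u0 enorm_ge0.
have vgt : 0 < enorm v by rewrite lt0r v0 enorm_ge0.
have := dot_ge0 (enorm v *: u - enorm u *: v).
rewrite dotBl !dotBr !dotZl !dotZr -!enorm_sqr (dotC v u) => h.
rewrite -subr_ge0 -(pmulr_rge0 _ (mulr_gt0 ugt vgt)) -(pmulr_rge0 _ (ltr0n _ 2)).
by apply: le_trans h _; apply: eqr_le; ring.
Qed.

Lemma rV_subE u v c : (u - v) 0 c = u 0 c - v 0 c.
Proof. by rewrite !mxE. Qed.

Lemma coord_le_norm u c : `|u 0 c| <= `|u|.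
Proof.
by rewrite [leRHS]mx_normrE (le_trans _ (le_bigmax _ _ (0, c))).
Qed.

Lemma norm_leP u a : 0 <= a -> (forall c, `|u 0 c| <= a) -> `|u| <= a.
Proof.
by move=> a0 ua; rewrite [leLHS]mx_normrE; apply: bigmax_le => // -[i c] _ /=;
  rewrite ord1.
Qed.

Lemma coord_le_enorm u c : `|u 0 c| <= enorm u.
Proof.
rewrite -ler_sqr ?nnegrE ?enorm_ge0// enorm_sqr real_normK ?num_real//.
rewrite /dot (bigD1 c)//= -expr2 lerDl; apply: sumr_ge0 => i _.
by rewrite -expr2 sqr_ge0.
Qed.

Lemma norm_le_enorm u : `|u| <= enorm u.
Proof. by apply: norm_leP; [exact: enorm_ge0|exact: coord_le_enorm]. Qed.

Lemma dot_le_norm u : dot u u <= d%:R * `|u| ^+ 2.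
Proof.
rewrite mulr_natl -[X in _ *+ X](card_ord d) -sumr_const; apply: ler_sum => c _.
by rewrite -expr2 -real_normK ?num_real// lerXn2r ?nnegrE ?coord_le_norm.
Qed.

Lemma enorm_le_norm u : enorm u <= d%:R * `|u|.
Proof.
have d0 : 0 <= d%:R * `|u| by rewrite mulr_ge0.
rewrite -ler_sqr ?nnegrE ?enorm_ge0// enorm_sqr (le_trans (dot_le_norm u))//.
rewrite exprMn ler_wpM2r ?sqr_ge0// -natrX ler_nat.
by have [->//|d_gt0] := posnP d; rewrite expnS expn1 leq_pmulr.
Qed.

Lemma enorm_triangle u v : enorm (u + v) <= enorm u + enorm v.
Proof.
rewrite -ler_sqr ?nnegrE ?addr_ge0 ?enorm_ge0// sqrrD !enorm_sqr.
rewrite dotDl !(dotC _ (u + v)) !dotDl (dotC v u).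
have := cauchy_schwarz u v; lra.
Qed.

End DotProduct.

(** * Bounded measurable functions and their means *)

(** All random quantities of a run are of this kind, a class closed under sums
    and products, so that integrability never has to be argued separately. *)
Definition bounded_measurable {R : realType} {dT} {T : measurableType dT}
    (Y : T -> R) : Prop :=
  measurable_fun setT Y /\ exists C, forall t, `|Y t| <= C.

Section BoundedMeasurable.
Context {R : realType} {dT} {T : measurableType dT}.
Implicit Types (Y Z : T -> R).
Local Notation bmeas := (@bounded_measurable R dT T).

Lemma bmeas_cst a : bmeas (fun=> a).
Proof. by split; [exact: measurable_cst|exists `|a|]. Qed.

Lemma bmeasD Y Z : bmeas Y -> bmeas Z -> bmeas (fun t => Y t + Z t).
Proof.
move=> [mY [C YC]] [mZ [C' ZC]]; split; first exact: measurable_funD.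
by exists (C + C') => t; rewrite (le_trans (ler_normD _ _))// lerD.
Qed.

Lemma bmeasM Y Z : bmeas Y -> bmeas Z -> bmeas (fun t => Y t * Z t).
Proof.
move=> [mY [C YC]] [mZ [C' ZC]]; split; first exact: measurable_funM.
by exists (C * C') => t; rewrite normrM ler_pM.
Qed.

Lemma bmeasZ a Y : bmeas Y -> bmeas (fun t => a * Y t).
Proof. by move=> mY; apply: bmeasM => //; exact: bmeas_cst. Qed.

Lemma bmeasB Y Z : bmeas Y -> bmeas Z -> bmeas (fun t => Y t - Z t).
Proof.
move=> mY mZ; apply: bmeasD => //.
by rewrite (_ : (fun t => - Z t) = fun t => -1 * Z t);
  [exact: bmeasZ|apply/funext => t; rewrite mulN1r].
Qed.

Lemma bmeasX Y n : bmeas Y -> bmeas (fun t => Y t ^+ n).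
Proof.
move=> mY; elim: n => [|n IHn]; first exact: bmeas_cst.
by rewrite (_ : (fun t => _) = fun t => Y t * Y t ^+ n);
  [exact: bmeasM|apply/funext => t; rewrite exprS].
Qed.

Lemma bmeas_sum (I : Type) (s : seq I) (Q : pred I) (Y : I -> T -> R) :
  (forall i, bmeas (Y i)) -> bmeas (fun t => \sum_(i <- s | Q i) Y i t).
Proof.
move=> mY; elim: s => [|i s IHs].
  rewrite (_ : (fun t => _) = fun=> 0); first exact: bmeas_cst.
  by apply/funext => t; rewrite big_nil.
rewrite (_ : (fun t => _) = fun t => (if Q i then Y i t else 0) +
                                     \sum_(i <- s | Q i) Y i t).
  by apply: bmeasD => //; case: (Q i); [exact: mY|exact: bmeas_cst].
by apply/funext => t; rewrite big_cons; case: ifP; rewrite ?add0r.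
Qed.

Lemma bmeas_comp {dS} {S : measurableType dS} (phi : S -> T) Y :
  measurable_fun setT phi -> bmeas Y -> bounded_measurable (Y \o phi).
Proof.
move=> mphi [mY [C YC]]; split; first exact: measurableT_comp.
by exists C => s /=.
Qed.

End BoundedMeasurable.

Section Expectation.
Context {R : realType} {dT} {T : measurableType dT}.
Variable Pr : probability T R.
Implicit Types (Y Z : T -> R).
Local Notation bmeas := (@bounded_measurable R dT T).
Local Notation Ex Y := (\int[Pr]_w Y w).

Lemma bmeas_integrable_finite (mu : {measure set T -> \bar R}) Y :
  (mu setT < +oo)%E -> bmeas Y -> mu.-integrable setT (EFin \o Y).
Proof.
move=> mufin [mY [C YC]]; apply: measurable_bounded_integrable => //.
by exists C; split; [exact: num_real|move=> x Cx t _; exact: le_trans (YC t) (ltW Cx)].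
Qed.

Lemma bmeas_integrable Y : bmeas Y -> Pr.-integrable setT (EFin \o Y).
Proof.
apply: bmeas_integrable_finite.
by rewrite (le_lt_trans (probability_le1 Pr measurableT))// ltry.
Qed.

Lemma EFin_mean Y : bmeas Y -> (\int[Pr]_w (Y w)%:E)%E = (Ex Y)%:E.
Proof.
move=> mY; rewrite /Rintegral fineK//; apply: integrable_fin_num => //.
exact: bmeas_integrable.
Qed.

Lemma meanD Y Z : bmeas Y -> bmeas Z -> Ex (fun w => Y w + Z w) = Ex Y + Ex Z.
Proof. by move=> mY mZ; apply: RintegralD => //; exact: bmeas_integrable. Qed.

Lemma meanB Y Z : bmeas Y -> bmeas Z -> Ex (fun w => Y w - Z w) = Ex Y - Ex Z.
Proof. by move=> mY mZ; apply: RintegralB => //; exact: bmeas_integrable. Qed.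

Lemma meanZ a Y : bmeas Y -> Ex (fun w => a * Y w) = a * Ex Y.
Proof. by move=> mY; apply: RintegralZl => //; exact: bmeas_integrable. Qed.

Lemma mean_cst a : Ex (fun=> a) = a.
Proof.
have Pr1 : (Pr setT = 1)%E := probability_setT Pr.
rewrite Rintegral_cst// -[RHS]mulr1; congr (_ * _).
by rewrite -[RHS]/(fine 1%E); congr fine; exact: Pr1.
Qed.

Lemma le_mean Y Z : bmeas Y -> bmeas Z -> (forall w, Y w <= Z w) -> Ex Y <= Ex Z.
Proof.
by move=> mY mZ YZ; apply: le_Rintegral => //; exact: bmeas_integrable.
Qed.

Lemma mean_sum (I : Type) (s : seq I) (Q : pred I) (Y : I -> T -> R) :
  (forall i, bmeas (Y i)) ->
  Ex (fun w => \sum_(i <- s | Q i) Y i w) = \sum_(i <- s | Q i) Ex (Y i).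
Proof.
move=> mY; elim: s => [|i s IHs].
  rewrite big_nil -[RHS]mean_cst; apply: eq_Rintegral => w _.
  by rewrite big_nil.
rewrite big_cons -IHs; case: ifP => Qi.
  rewrite -meanD//; last exact: bmeas_sum.
  by apply: eq_Rintegral => w _; rewrite big_cons Qi.
by apply: eq_Rintegral => w _; rewrite big_cons Qi.
Qed.

(** Pythagoras in L^2: [W] is the error accumulated so far and the [a i] are
    new contributions, orthogonal to it and to each other. *)
Lemma mean_sqr_orthogonal (I : eqType) (s : seq I) (a : I -> T -> R) W :
  bmeas W -> (forall i, bmeas (a i)) -> uniq s ->
  (forall i, i \in s -> Ex (fun w => W w * a i w) = 0) ->
  (forall i j, i \in s -> j \in s -> i != j -> Ex (fun w => a i w * a j w) = 0) ->
  Ex (fun w => (W w + \sum_(i <- s) a i w) ^+ 2) =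
  Ex (fun w => W w ^+ 2) + \sum_(i <- s) Ex (fun w => a i w ^+ 2).
Proof.
move=> mW ma; elim: s W mW => [|i s IHs] W mW /=.
  move=> _ _ _; rewrite big_nil addr0; apply: eq_Rintegral => w _.
  by rewrite big_nil addr0.
move=> /andP[iNs us] W0 a0.
have mWa : bmeas (fun w => W w + a i w) by exact: bmeasD.
under eq_Rintegral do rewrite big_cons addrA.
rewrite (IHs (fun w => W w + a i w))//; first last.
- by move=> j k js ks; apply: a0; rewrite in_cons ?js ?ks orbT.
- move=> j js; under eq_Rintegral do rewrite mulrDl.
  rewrite meanD; [|exact: bmeasM..].
  rewrite W0 ?in_cons ?js ?orbT// a0 ?addr0 ?in_cons ?eqxx ?js ?orbT//.
  by apply: contraNneq iNs => ->.
rewrite big_cons addrA; congr (_ + _).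
under eq_Rintegral do rewrite sqrrD -mulr_natl.
rewrite !meanD; [|by do ?[exact: bmeasX|apply: bmeasZ|apply: bmeasD|apply: bmeasM]..].
rewrite meanZ; last exact: bmeasM.
by rewrite W0 ?mem_head// mulr0 addr0.
Qed.

End Expectation.

Section Caratheodory.
Context {R : realType} {d : nat} {dT} {T : measurableType dT}.
Implicit Types (X : T -> 'rV[R]_d) (K : set 'rV[R]_d).

Lemma measurable_bigmax (I : Type) (s : seq I) (F : I -> T -> R) (a : T -> R) :
  measurable_fun setT a -> (forall i, measurable_fun setT (F i)) ->
  measurable_fun setT (fun t => \big[Num.max/a t]_(i <- s) F i t).
Proof.
move=> ma mF; elim: s => [|i s IHs].
  by under eq_fun do rewrite big_nil.
by under eq_fun do rewrite big_cons; exact: measurable_maxr.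
Qed.

Lemma measurable_bigmin (I : Type) (s : seq I) (F : I -> T -> R) (a : T -> R) :
  measurable_fun setT a -> (forall i, measurable_fun setT (F i)) ->
  measurable_fun setT (fun t => \big[Num.min/a t]_(i <- s) F i t).
Proof.
move=> ma mF; elim: s => [|i s IHs].
  by under eq_fun do rewrite big_nil.
by under eq_fun do rewrite big_cons; exact: measurable_minr.
Qed.

Lemma measurable_norm_rV X :
  (forall c, measurable_fun setT (fun t => X t 0 c)) ->
  measurable_fun setT (fun t => `|X t|).
Proof.
move=> mX; rewrite (_ : (fun t => _) = fun t =>
    \big[Num.max/0]_(i : 'I_1 * 'I_d) `|X t 0 i.2|).
  by apply: measurable_bigmax => // i; exact: measurableT_comp.
apply/funext => t; rewrite [LHS]mx_normrE; apply: eq_bigr => -[i c] _.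
by rewrite ord1.
Qed.

Lemma compact_finite_net K (e : R) : compact K -> 0 < e ->
  exists2 s : seq 'rV[R]_d, (forall y, y \in s -> K y) &
    forall x, K x -> exists2 y, y \in s & `|x - y| < e.
Proof.
rewrite compact_cover => cK e0.
have [|x Kx|D DK KD] := cK _ K (fun y => ball y e).
- by move=> y _; exact: ball_open.
- by exists x => //; exact: ballxx.
exists (enum_fset D) => [y yD|x /KD[y /= yD xy]].
  by have := DK y yD; rewrite inE.
exists y => //; move: xy; rewrite -ball_normE /= distrC; exact.
Qed.

(** A function that is measurable in t and Lipschitz in x may be evaluated at
    a measurable random point of a compact set.  On a finite 1/(n+1)-net s of K,
    the lower envelope
      min_(y in s) (chi y t + C |X t - y|)
    is measurable in t, and it exceeds chi (X t) t by at most 2 C / (n+1). *)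
Lemma measurable_lipschitz_comp K (chi : 'rV[R]_d -> T -> R) C X :
  compact K -> 0 <= C ->
  (forall x, K x -> measurable_fun setT (chi x)) ->
  (forall x y t, K x -> K y -> chi x t - chi y t <= C * `|x - y|) ->
  (forall t, K (X t)) -> (forall c, measurable_fun setT (fun t => X t 0 c)) ->
  measurable_fun setT (fun t => chi (X t) t).
Proof.
move=> cK C0 mchi lip KX mX.
have [s_ sK snet] : exists2 s_ : nat -> seq 'rV[R]_d,
    (forall n y, y \in s_ n -> K y) &
    forall n x, K x -> exists2 y, y \in s_ n & `|x - y| < n.+1%:R^-1.
  have net n : {s : seq 'rV[R]_d | (forall y, y \in s -> K y) /\
      forall x, K x -> exists2 y, y \in s & `|x - y| < n.+1%:R^-1}.
    apply: cid; have [|s sK sn] := compact_finite_net (e := n.+1%:R^-1) cK.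
      by rewrite invr_gt0.
    by exists s.
  exists (fun n => sval (net n)) => n; by case: (svalP (net n)).
pose x0 := X point; have Kx0 : K x0 by exact: KX.
pose z y := if y \in K then y else x0.
have Kz y : K (z y) by rewrite /z; case: ifP => //; rewrite inE.
pose F y t := chi (z y) t + C * `|X t - z y|.
have mF y : measurable_fun setT (F y).
  rewrite /F; apply: measurable_funD; first exact: mchi.
  apply: measurable_funM => //; apply: measurable_norm_rV => c.
  under eq_fun do rewrite mxE; apply: measurable_funD => //.
pose g n t := \big[Num.min/F x0 t]_(y <- s_ n) F y t.
have F_ge y t : chi (X t) t <= F y t.
  by rewrite /F -lerBlDl lip.
have g_ge n t : chi (X t) t <= g n t.
  by rewrite /g; elim: (s_ n) => [|y s IHs]; rewrite ?big_nil ?big_cons ?le_min F_ge.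
have g_le n t : g n t <= chi (X t) t + 2 * C * n.+1%:R^-1.
  have [y ys Xy] := snet n (X t) (KX t).
  have Ky : K y := sK n y ys.
  apply: (@le_trans _ _ (F y t)).
    rewrite /g; elim: (s_ n) ys => // y' s IHs; rewrite in_cons big_cons ge_min.
    by move=> /orP[/eqP->|/IHs->]; rewrite ?lexx ?orbT.
  have zy : z y = y by rewrite /z mem_set.
  rewrite /F zy -lerBlDl addrAC.
  rewrite (@le_trans _ _ (C * `|y - X t| + C * `|X t - y|))//.
    by rewrite lerD2r lip.
  by rewrite distrC -mulrA mulr_natl mulr2n lerD// ler_wpM2l// ltW.
apply: (@measurable_fun_cvg _ _ _ setT g).
  by move=> n; apply: measurable_bigmin.
move=> t _; apply: (@squeeze_cvgr _ _ _ _ (fun=> chi (X t) t)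
  (fun n => chi (X t) t + 2 * C * n.+1%:R^-1)).
- by near=> n; rewrite g_ge g_le.
- exact: cvg_cst.
- rewrite -[X in _ --> X]addr0; apply: cvgD; first exact: cvg_cst.
  rewrite -[X in _ --> X](mulr0 (2 * C)); apply: cvgM; first exact: cvg_cst.
  exact: cvg_harmonic.
Unshelve. all: by end_near.
Qed.

End Caratheodory.

(** * Integrating out an independent variable *)

Section Freezing.
Context {R : realType} {dO dT} {Omega : measurableType dO} {T : measurableType dT}.
Variables (Pr : probability Omega R) (G : set (set Omega)) (U : {RV Pr >-> T}).
Local Notation OmegaG := (g_sigma_algebraType G).
Hypothesis G_measurable : G `<=` measurable.
Hypothesis G_U_independent : forall A B, <<s G >> A -> measurable B ->
  (Pr (A `&` U @^-1` B) = Pr A * Pr (U @^-1` B))%E.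

Lemma measurable_id_coarse : measurable_fun setT (id : Omega -> OmegaG).
Proof.
move=> _ A GA; rewrite setTI.
by apply: (smallest_sub _ G_measurable GA); exact: sigma_algebra_measurable.
Qed.

Lemma measurable_pair_coarse :
  measurable_fun setT (fun w => (w, U w) : OmegaG * T).
Proof. by apply: measurable_fun_pair => //; exact: measurable_id_coarse. Qed.

(** By independence the pair (w, U w), with w seen only through the
    sigma-algebra generated by G, has a product law.  Fubini's theorem then
    reduces the mean to the means over U for fixed w. *)
Lemma freezing_le (Phi : OmegaG * T -> R) (c : R) :
  bounded_measurable Phi ->
  (forall w, \int[distribution Pr U]_u Phi (w, u) <= c) ->
  \int[Pr]_w Phi (w, U w) <= c.
Proof.
move=> mPhi Phi_c.
pose idG : {mfun Omega >-> OmegaG} := mfun_Sub (mem_set measurable_id_coarse).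
pose pairG : {mfun Omega >-> (OmegaG * T)%type} := mfun_Sub (mem_set measurable_pair_coarse).
pose mu : probability OmegaG R := distribution Pr idG.
pose nu : probability T R := distribution Pr U.
pose rho : probability (OmegaG * T)%type R := distribution Pr pairG.
have mPhi1 : bounded_measurable (fun w => Phi (w, U w)).
  exact: bmeas_comp measurable_pair_coarse mPhi.
have rhoE A : measurable A -> (mu \x nu)%E A = rho A.
  apply: product_measure_unique => B C mB mC.
  rewrite /mu /nu /rho /= /distribution /pushforward /=.
  by rewrite -G_U_independent//; congr (Pr _).
have intPhi : (mu \x nu)%E.-integrable setT (EFin \o Phi).
  have munu_fin : ((mu \x nu)%E setT < +oo)%E.
    by rewrite rhoE// (le_lt_trans (probability_le1 rho measurableT))// ltry.
  exact: bmeas_integrable_finite munu_fin mPhi.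
have eqE : (\int[Pr]_w (Phi (w, U w))%:E = \int[mu]_w \int[nu]_u (Phi (w, u))%:E)%E.
  have -> := integral12_prod_meas1 intPhi.
  rewrite (@eq_measure_integral _ _ _ _ rho)//; last by move=> A mA _; exact: rhoE.
  rewrite integral_distribution//; first by case: mPhi => /measurable_EFinP.
  exact: bmeas_integrable mPhi1.
rewrite -lee_fin -EFin_mean// eqE.
have -> : c%:E = (\int[mu]_w (cst c%:E w))%E.
  have mu1 : mu setT = 1%E := probability_setT mu.
  by rewrite integral_cst// -[LHS]mule1; congr (_ * _)%E; exact/esym.
apply: le_integral => //.
- exact: integrable_fubini_F intPhi.
- by apply: bmeas_integrable; exact: bmeas_cst.
move=> w _ /=.
rewrite EFin_mean ?lee_fin ?Phi_c//; split; last by case: mPhi => _ [C PhiC]; exists C.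
by apply: measurableT_comp (proj1 mPhi) _; exact: measurable_pair1.
Qed.

Lemma freezing_eq0 (Phi : OmegaG * T -> R) :
  bounded_measurable Phi ->
  (forall w, \int[distribution Pr U]_u Phi (w, u) = 0) ->
  \int[Pr]_w Phi (w, U w) = 0.
Proof.
move=> mPhi Phi0.
have mPhiU w : bounded_measurable (fun u => Phi (w, u)).
  by apply: bmeas_comp mPhi; exact: measurable_pair1.
have le0 : \int[Pr]_w Phi (w, U w) <= 0.
  by apply: (freezing_le mPhi) => w; rewrite Phi0.
have ge0 : \int[Pr]_w (- 1 * Phi (w, U w)) <= 0.
  apply: (freezing_le (Phi := fun p => -1 * Phi p)) => [|w]; first exact: bmeasZ.
  by rewrite meanZ// Phi0 mulr0.
apply/eqP; rewrite eq_le le0 -oppr_le0 -mulN1r -meanZ//.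
exact: bmeas_comp measurable_pair_coarse mPhi.
Qed.

End Freezing.

(** * Independence of a draw from a family of draws *)

Section Independence.
Context {R : realType} {dO} {Omega : measurableType dO} {I : eqType}.
Variables (Pr : probability Omega R) (F : I -> set (set Omega)).
Hypothesis F_measurable : forall i, F i `<=` measurable.
Hypothesis F_setI : forall i, setI_closed (F i).
Hypothesis F_setT : forall i, F i setT.
Hypothesis F_independent : mutually_independent Pr F.

(** Generates the information carried by the indices in [E]; for draws up to
    round t the generated sigma-algebra is [history t]. *)
Definition family_events (E : set I) : set (set Omega) := \bigcup_(i in E) F i.

Let cylinders (E : set I) : set (set Omega) :=
  [set \bigcap_(i in [set` sA.1]) sA.2 i | sA in
    [set sA : seq I * (I -> set Omega) |
      [/\ uniq sA.1, forall i, i \in sA.1 -> E i & forall i, F i (sA.2 i)]]].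

Lemma family_events_measurable E : family_events E `<=` measurable.
Proof. by move=> A [i _]; exact: F_measurable. Qed.

Let cylinders_measurable E : cylinders E `<=` measurable.
Proof.
move=> _ [[s A] /= [us sE FA] <-]; apply: fin_bigcap_measurable => // i _.
exact: F_measurable (FA i).
Qed.

Let cylinders_setI E : setI_closed (cylinders E).
Proof.
move=> _ _ [[s A] /= [us sE FA] <-] [[r B] /= [ur rE FB] <-].
exists (undup (s ++ r), fun i =>
   (if i \in s then A i else setT) `&` (if i \in r then B i else setT)) => /=.
  split; first exact: undup_uniq.
    by move=> i; rewrite mem_undup mem_cat => /orP[/sE|/rE].
  by move=> i; apply: F_setI; case: ifP.
apply/seteqP; split => [w AB|w [Aw Bw] i /=]; last first.
  rewrite mem_undup mem_cat => _; split; case: ifP => // ir.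
    exact: Aw. exact: Bw.
split => i /= ir.
  by have := AB i; rewrite /= mem_undup mem_cat ir => /(_ isT)[].
by have := AB i; rewrite /= mem_undup mem_cat ir orbT => /(_ isT)[].
Qed.

Let family_events_cylinder E : family_events E `<=` cylinders E.
Proof.
move=> A [i Ei FA]; exists ([:: i], fun j => if j == i then A else setT) => /=.
  split=> // [j|j]; first by rewrite inE => /eqP->.
  by case: eqP => [->|].
apply/seteqP; split => [w|w Aw j /=]; last by rewrite inE => /eqP ->; rewrite eqxx.
by move=> /(_ i) /=; rewrite inE eqxx; exact.
Qed.

(** The finite intersections of events of [F i], i in E, form a pi-system that
    generates the sigma-algebra of [E].  On it the measures A |-> Pr (A & B) and
    A |-> Pr A * Pr B agree by mutual independence, so they agree on the whole
    sigma-algebra. *)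
Lemma independent_of_family (E : set I) (j : I) A B : ~ E j ->
  <<s family_events E >> A -> F j B -> (Pr (A `&` B) = Pr A * Pr B)%E.
Proof.
move=> jE EA FB; have mB : measurable B := F_measurable FB.
pose PB := NngNum (fine_ge0 (measure_ge0 Pr B)).
have PBE : PB%:num%:E = Pr B by rewrite /= fineK// fin_num_measure.
have -> : (Pr A * Pr B = mscale PB Pr A)%E by rewrite /mscale PBE muleC.
rewrite -[LHS]/(mrestr Pr mB A).
apply: (@g_sigma_algebra_measure_unique _ _ _ (cylinders E) _ (fun=> setT)).
- exact: cylinders_measurable.
- move=> _; exists ([::], fun=> setT) => //=.
  by rewrite set_nil bigcap_set0.
- by rewrite bigcup_const//; exists 0%N.
- exact: cylinders_setI.
- move=> _ [[s C] /= [us sE FC] <-]; rewrite /mrestr /mscale PBE muleC.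
  have js : j \notin s by apply/negP => /sE.
  (* Adjoin j to the finite family, with event B. *)
  pose C' i := if i == j then B else C i.
  have C'E i : i \in s -> C' i = C i.
    by move=> si; rewrite /C'; case: eqP => // ij; rewrite -ij si in js.
  have -> : \bigcap_(i in [set` s]) C i `&` B = \bigcap_(i in [set` j :: s]) C' i.
    apply/seteqP; split => [w [Cw Bw] i /=|w Cw].
      by rewrite in_cons /C'; case: eqP => //= _ /Cw.
    split => [i /= si|]; last first.
      by have := Cw j; rewrite /= mem_head /C' eqxx; exact.
    by have := Cw i; rewrite /= in_cons si orbT C'E//; exact.
  have FC' i : F i (C' i) by rewrite /C'; case: eqP => [->|].
  rewrite (F_independent (s := j :: s)) ?cons_uniq ?js// big_cons muleC {2}/C' eqxx.
  congr (_ * _)%E; have PC := F_independent us (fun i _ => FC i).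
  by rewrite [RHS]PC; apply: eq_big_seq => i /C'E ->.
- move=> _; rewrite /= /mrestr setTI.
  by rewrite (le_lt_trans (probability_le1 Pr mB))// ltry.
- apply: smallest_sub EA; first exact: smallest_sigma_algebra.
  by move=> C /family_events_cylinder EC; exact: sub_sigma_algebra.
Qed.
End Independence.

(** * The s-partition encoding *)

Section Quantization.
Context {R : realType}.
Implicit Types (r y a : R).

(** The probability of rounding up, r s - l in the description of the scheme. *)
Definition rounding_prob (s : nat) r : R :=
  r * s%:R - (minn (Num.truncn (r * s%:R)) s.-1)%:R.

Lemma rounding_prob_itv s r : (0 < s)%N -> 0 <= r <= 1 ->
  0 <= rounding_prob s r <= 1.
Proof.
move=> s0 /andP[r0 r1]; rewrite /rounding_prob.
have rs0 : 0 <= r * s%:R by rewrite mulr_ge0.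
have rss : r * s%:R <= s%:R by rewrite ler_piMl.
have /andP[le lt] := truncn_itv rs0.
rewrite subr_ge0 lerBlDr; apply/andP; split.
  by rewrite (le_trans _ le)// ler_nat geq_minl.
rewrite /minn; case: ifP => _; first by rewrite addrC -natr1 in lt *; exact: ltW.
by rewrite addrC natr1 prednK.
Qed.

Lemma partition_roundE s (u r : R) :
  partition_round s u r =
  r * s%:R / s%:R + ((u < rounding_prob s r)%R%:R - rounding_prob s r) / s%:R.
Proof.
rewrite /partition_round -/(rounding_prob s r) -mulrDl; congr (_ / _).
rewrite [in RHS]/rounding_prob; set l := minn _ _.
case: ifP => _ /=; rewrite ?mulr1n ?mulr0n -?natr1; ring.
Qed.

Lemma partition_round_itv s (u r : R) : (0 < s)%N ->
  0 <= partition_round s u r <= 1.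
Proof.
move=> s0; rewrite /partition_round; set l := minn _ _.
have ls : (l < s)%N by rewrite -(prednK s0) ltnS geq_minr.
rewrite divr_ge0//= ler_pdivrMr ?ltr0n// mul1r ler_nat.
by case: ifP => // _; exact: ltnW.
Qed.

Section Vector.
Context {d : nat}.
Implicit Types (g : 'rV[R]_d) (u : 'I_d -> R).

(** A centered Bernoulli variable when the seed [v] is uniform: this is the whole
    randomness of the encoding of one coordinate. *)
Definition rounding_gap s (v : R) g c : R :=
  (v < rounding_prob s (`|g 0 c| / `|g|))%R%:R - rounding_prob s (`|g 0 c| / `|g|).

Lemma ratio_itv g c : 0 <= `|g 0 c| / `|g| <= 1.
Proof.
rewrite divr_ge0//=; have [->|g0] := eqVneq `|g| 0; first by rewrite invr0 mulr0.
by rewrite ler_pdivrMr ?lt0r ?g0 ?normr_ge0// mul1r coord_le_norm.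
Qed.

(** Decoding returns g plus a multiple, independent of the seed, of the centered
    variable [rounding_gap]. *)
Lemma quantizeE s u g c : (0 < s)%N ->
  quantize s u g 0 c =
  g 0 c + Num.sg (g 0 c) * `|g| / s%:R * rounding_gap s (u c) g c.
Proof.
move=> s0; have sN0 : s%:R != 0 :> R by rewrite pnatr_eq0 -lt0n.
rewrite mxE partition_roundE -/(rounding_gap s (u c) g c) mulfK//.
(* If g = 0 the ratio is a division by zero, but the sign factor vanishes. *)
have [g0|g0] := eqVneq `|g| 0.
  have /eqP -> : g 0 c == 0 by rewrite -normr_le0 -g0 coord_le_norm.
  by rewrite sgr0 !mul0r addr0.
rewrite {3}[g 0 c]numEsg; field.
by rewrite sN0 g0.
Qed.

Lemma rounding_gap_le1 s v g c : (0 < s)%N -> `|rounding_gap s v g c| <= 1.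
Proof.
move=> s0; have /andP[p0 p1] := rounding_prob_itv s0 (ratio_itv g c).
by rewrite /rounding_gap; case: (_ < _) => /=; rewrite ler_norml; lra.
Qed.

Lemma quantize_error_le s u g c : (0 < s)%N ->
  `|quantize s u g 0 c - g 0 c| <= `|g| / s%:R.
Proof.
move=> s0; rewrite quantizeE// addrC addKr !normrM normfV normr_id normr_nat.
rewrite -[leRHS]mulr1 ler_pM ?rounding_gap_le1//.
rewrite -mulrA ler_piMl// ?divr_ge0//.
by have [->|n0] := eqVneq (g 0 c) 0; rewrite ?sgr0 ?normr0// normr_sg n0.
Qed.

Lemma norm_quantize_le s u g : (0 < s)%N -> `|quantize s u g| <= `|g|.
Proof.
move=> s0; apply: norm_leP => // c; rewrite mxE.
have /andP[q0 q1] := partition_round_itv (u c) (`|g 0 c| / `|g|) s0.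
rewrite normrM normr_id normrM (ger0_norm q0) ler_piMl// mulr_ile1//.
by have [->|n0] := eqVneq (g 0 c) 0; rewrite ?sgr0 ?normr0// normr_sg n0.
Qed.

End Vector.

Section Measurability.
Context {d : nat} {dT} {T : measurableType dT}.

Lemma measurable_lt_indicator (f g : T -> R) :
  measurable_fun setT f -> measurable_fun setT g ->
  measurable_fun setT (fun t => (f t < g t)%R%:R : R).
Proof.
move=> mf mg; rewrite (_ : (fun t => _) = fun t => if f t < g t then 1 else 0).
  by apply: measurable_fun_ifT => //; exact: measurable_fun_ltr.
by apply/funext => t; case: ifP.
Qed.

(** Writes the integer l of the scheme as a sum of indicators, which makes it
    visibly measurable in y. *)
Lemma minn_truncnE y n : 0 <= y ->
  (minn (Num.truncn y) n)%:R = \sum_(j < n) (j.+1%:R <= y)%R%:R :> R.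
Proof.
move=> y0; elim: n => [|n IHn]; first by rewrite minn0 big_ord0.
have minnS m : minn m n.+1 = (minn m n + (n < m))%N.
  case: ltnP => h; first by rewrite (minn_idPr h) addn1.
  by rewrite (minn_idPl (leqW h)) addn0.
by rewrite big_ord_recr /= -IHn -truncn_ge_nat// -natrD minnS.
Qed.

Lemma measurable_rounding_prob s (r : T -> R) :
  measurable_fun setT r -> (forall t, 0 <= r t) ->
  measurable_fun setT (fun t => rounding_prob s (r t)).
Proof.
move=> mr r0.
rewrite (_ : (fun t => _) = fun t =>
    r t * s%:R - \sum_(j < s.-1) (1 - (r t * s%:R < j.+1%:R)%R%:R)).
  apply: measurable_funB; first exact: measurable_funM.
  apply: measurable_sum => j; apply: measurable_funB => //.
  by apply: measurable_lt_indicator => //; exact: measurable_funM.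
apply/funext => t; rewrite /rounding_prob minn_truncnE ?mulr_ge0//.
congr (_ - _); apply: eq_bigr => j _; rewrite ltNge.
by case: (_ <= _); rewrite ?subr0 ?subrr.
Qed.

Lemma measurable_ratio (g : T -> 'rV[R]_d) c :
  (forall c, measurable_fun setT (fun t => g t 0 c)) ->
  measurable_fun setT (fun t => `|g t 0 c| / `|g t|).
Proof.
move=> mg; apply: measurable_funM; first exact: measurableT_comp.
rewrite (_ : (fun t => _) = fun t => `|g t| `^ (-1)).
  have mp : measurable_fun setT (@powR R ^~ (-1)) := @measurable_powR R (-1).
  by apply: (measurableT_comp mp); exact: measurable_norm_rV.
by apply/funext => t; rewrite powR_inv1.
Qed.

Lemma measurable_sgr (f : T -> R) : measurable_fun setT f ->
  measurable_fun setT (fun t => Num.sg (f t)).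
Proof.
move=> mf; rewrite (_ : (fun t => _) = fun t => (0 < f t)%R%:R - (f t < 0)%R%:R).
  by apply: measurable_funB; exact: measurable_lt_indicator.
by apply/funext => t; case: sgrP; rewrite ?subr0 ?sub0r ?subrr.
Qed.

Lemma measurable_rounding_gap s (v : T -> R) (g : T -> 'rV[R]_d) c :
  measurable_fun setT v ->
  (forall c, measurable_fun setT (fun t => g t 0 c)) ->
  measurable_fun setT (fun t => rounding_gap s (v t) (g t) c).
Proof.
move=> mv mg.
have mp : measurable_fun setT (fun t => rounding_prob s (`|g t 0 c| / `|g t|)).
  apply: measurable_rounding_prob; first exact: measurable_ratio.
  by move=> t; rewrite divr_ge0.
by apply: measurable_funB => //; exact: measurable_lt_indicator.
Qed.

End Measurability.

(** The probability that a uniform seed falls below a is a, so rounding is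
    unbiased. *)
Lemma uniform_mean_lt (mu : probability R R) a : 0 <= a <= 1 ->
  (forall A, measurable A -> mu A = uniform_prob (@ltr01 R) A) ->
  \int[mu]_u ((u < a)%R%:R - a) = 0.
Proof.
move=> /andP[a0 a1] muE.
have mlt : measurable_fun setT (fun u : R => (u < a)%R%:R : R).
  exact: measurable_lt_indicator.
have blt : bounded_measurable (fun u : R => (u < a)%R%:R : R).
  by split => //; exists 1 => u; case: (_ < _); rewrite ?normr1 ?normr0.
rewrite meanB//; last exact: bmeas_cst.
rewrite mean_cst; apply/eqP; rewrite subr_eq0; apply/eqP.
rewrite /Rintegral (eq_integral (fun u => (\1_(`]-oo, a[%classic) u)%:E)); last first.
  by move=> u _; rewrite indicE mem_setE in_itv /=.
rewrite integral_indic// setIT [X in fine X]muE// /uniform_prob integral_uniform_pdf.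
rewrite (_ : _ `&` _ = `[0, a[%classic); last first.
  apply/seteqP; split => [u /=|u /=]; rewrite !in_itv /=; first by lra.
  by move=> /andP[-> ua] /=; rewrite ua (le_trans (ltW ua)).
rewrite (eq_integral (fun=> 1%:E)); last first.
  move=> u; rewrite inE /= in_itv /= => /andP[u0 ua].
  by rewrite /uniform_pdf u0 (le_trans (ltW ua) a1) /= subr0 invr1.
rewrite integral_cst//= mul1e lebesgue_measure_itv /= lte_fin.
by case: ltgtP a0 => //=; rewrite ?subr0.
Qed.

End Quantization.

(** * Functions known from a set of draws *)

Section BoundedVectors.
Context {R : realType} {d : nat} {dT} {T : measurableType dT}.
Implicit Types X : T -> 'rV[R]_d.

Definition bounded_measurable_rV X : Prop :=
  forall c, bounded_measurable (fun t => X t 0 c).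

Lemma bmeas_dot X Y : bounded_measurable_rV X -> bounded_measurable_rV Y ->
  bounded_measurable (fun t => dot (X t) (Y t)).
Proof. by move=> mX mY; apply: bmeas_sum => c; exact: bmeasM. Qed.

Lemma bmeas_norm X : bounded_measurable_rV X ->
  bounded_measurable (fun t => `|X t|).
Proof.
move=> mX; split; first by apply: measurable_norm_rV => c; case: (mX c).
have [_ [C XC]] := bmeas_dot mX mX; exists (1 + C) => t.
rewrite normr_id; have := XC t; rewrite ger0_norm ?dot_ge0// -enorm_sqr => XtC.
have := norm_le_enorm (X t); have := enorm_ge0 (X t); nra.
Qed.

Lemma bmeas_rV_cst x : bounded_measurable_rV (fun=> x).
Proof. by move=> c; exact: bmeas_cst. Qed.

Lemma bmeas_rVD X Y : bounded_measurable_rV X -> bounded_measurable_rV Y ->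
  bounded_measurable_rV (fun t => X t + Y t).
Proof. by move=> mX mY c; under eq_fun do rewrite mxE; exact: bmeasD. Qed.

Lemma bmeas_rVZ a X : bounded_measurable_rV X ->
  bounded_measurable_rV (fun t => a *: X t).
Proof. by move=> mX c; under eq_fun do rewrite mxE; exact: bmeasZ. Qed.

Lemma bmeas_rVB X Y : bounded_measurable_rV X -> bounded_measurable_rV Y ->
  bounded_measurable_rV (fun t => X t - Y t).
Proof.
by move=> mX mY c; under eq_fun do rewrite !mxE; exact: bmeasB.
Qed.

Lemma bmeas_rV_sum (I : Type) (s : seq I) (X : I -> T -> 'rV[R]_d) :
  (forall i, bounded_measurable_rV (X i)) ->
  bounded_measurable_rV (fun t => \sum_(i <- s) X i t).
Proof.
by move=> mX c; under eq_fun do rewrite summxE; apply: bmeas_sum => i; exact: mX.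
Qed.

Lemma bmeas_rounding_error s (v : T -> R) X c : (0 < s)%N ->
  measurable_fun setT v -> bounded_measurable_rV X ->
  bounded_measurable (fun t =>
    Num.sg (X t 0 c) * `|X t| / s%:R * rounding_gap s (v t) (X t) c).
Proof.
move=> s0 mv mX; apply: bmeasM; last first.
  split; last by exists 1 => t; exact: rounding_gap_le1.
  by apply: measurable_rounding_gap => // c'; case: (mX c').
under eq_fun do rewrite mulrC; apply/bmeasZ/bmeasM; last exact: bmeas_norm.
split; first by apply: measurable_sgr; case: (mX c).
exists 1 => t; rewrite normr_sg; by case: (_ != _).
Qed.

Lemma bmeas_quantize s (v : T -> 'I_d -> R) X : (0 < s)%N ->
  (forall c, measurable_fun setT (v ^~ c)) -> bounded_measurable_rV X ->
  bounded_measurable_rV (fun t => quantize s (v t) (X t)).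
Proof.
move=> s0 mv mX c; under eq_fun do rewrite quantizeE//.
by apply: bmeasD => //; exact: bmeas_rounding_error.
Qed.

End BoundedVectors.

Section Observables.
Context {R : realType} {dO} {Omega : measurableType dO} {I : eqType}.
Variables (Pr : probability Omega R) (F : I -> set (set Omega)).
Hypothesis F_measurable : forall i, F i `<=` measurable.
Hypothesis F_setI : forall i, setI_closed (F i).
Hypothesis F_setT : forall i, F i setT.
Hypothesis F_independent : mutually_independent Pr F.
Implicit Types (E : set I) (Y : Omega -> R).

Local Notation Known E := (g_sigma_algebraType (family_events F E)).

(** The information in [E] is carried by the type of the domain, so that the
    closure properties of measurable functions apply to it verbatim. *)
Definition observable E Y := bounded_measurable (Y : Known E -> R).
Definition observable_rV d E (X : Omega -> 'rV[R]_d) :=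
  bounded_measurable_rV (X : Known E -> 'rV[R]_d).

Lemma measurable_known_sub E E' {dT} {T : measurableType dT} (Y : Omega -> T) :
  E `<=` E' -> measurable_fun setT (Y : Known E -> T) ->
  measurable_fun setT (Y : Known E' -> T).
Proof.
move=> EE' mY _ B mB; have := mY measurableT B mB; rewrite !setTI.
apply: sub_sigma_algebra2 => A [i Ei FA]; exists i => //; exact: EE'.
Qed.

Lemma observable_sub E E' Y : E `<=` E' -> observable E Y -> observable E' Y.
Proof. by move=> EE' [mY bY]; split => //; exact: measurable_known_sub mY. Qed.

Lemma observable_rV_sub d E E' (X : Omega -> 'rV[R]_d) : E `<=` E' ->
  observable_rV E X -> observable_rV E' X.
Proof. by move=> EE' mX c; exact: observable_sub (mX c). Qed.

Lemma observable_bmeas E Y : observable E Y -> bounded_measurable Y.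
Proof.
move=> mY; apply: bmeas_comp mY; apply: measurable_id_coarse.
exact: family_events_measurable.
Qed.

Lemma observable_rV_bmeas d E (X : Omega -> 'rV[R]_d) :
  observable_rV E X -> bounded_measurable_rV X.
Proof. by move=> mX c; exact: observable_bmeas (mX c). Qed.

Lemma draw_known E i {dT} {T : measurableType dT} (U : Omega -> T) :
  E i -> F i = preimage_set_system setT U measurable ->
  measurable_fun setT (U : Known E -> T).
Proof.
move=> Ei FE _ B mB; apply: sub_sigma_algebra; exists i => //.
by rewrite FE; exists B.
Qed.

Section Innovation.
Context {dT} {T : measurableType dT} (U : {RV Pr >-> T}) (i : I) (E : set I).
Hypothesis FU : F i = preimage_set_system setT U measurable.
Hypothesis iE : ~ E i.

Let innovation_independent A B : <<s family_events F E >> A -> measurable B ->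
  (Pr (A `&` U @^-1` B) = Pr A * Pr (U @^-1` B))%E.
Proof.
move=> EA mB; apply: (independent_of_family _ _ _ _ iE) => //.
by rewrite FU; exists B; rewrite ?setTI.
Qed.

Let known_measurable : family_events F E `<=` measurable.
Proof. exact: family_events_measurable. Qed.

Section Sample.
Context {d : nat} (K : set 'rV[R]_d) (chi : 'rV[R]_d -> T -> R) (C B : R).
Variable X : Omega -> 'rV[R]_d.
Hypothesis K_compact : compact K.
Hypothesis C_ge0 : 0 <= C.
Hypothesis chi_measurable : forall x, K x -> measurable_fun setT (chi x).
Hypothesis chi_bounded : forall x u, K x -> `|chi x u| <= B.
Hypothesis chi_lipschitz : forall x y u, K x -> K y ->
  chi x u - chi y u <= C * `|x - y|.
Hypothesis X_in : forall w, K (X w).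
Hypothesis X_observable : observable_rV E X.

Let bmeas_chi : bounded_measurable (fun p : Known E * T => chi (X p.1) p.2).
Proof.
split; last by exists B => p; exact: chi_bounded.
apply: (@measurable_lipschitz_comp _ _ _ _ K (fun x p => chi x p.2) C) => //.
- by move=> x Kx; apply: measurableT_comp => //; exact: chi_measurable.
- by move=> x y p; exact: chi_lipschitz.
- by move=> c; case: (X_observable c) => mX _; apply: (measurableT_comp mX).
Qed.

(** Conditional mean bound for a fresh sample [U] at a random point [X] that
    depends on other draws only: freeze [X]. *)
Lemma sample_mean_le a :
  (forall x, K x -> \int[distribution Pr U]_u chi x u <= a) ->
  \int[Pr]_w chi (X w) (U w) <= a.
Proof.
move=> chi_a; apply: (freezing_le known_measurable innovation_independent bmeas_chi).
by move=> w; exact: chi_a (X_in w).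
Qed.

(** The test function [Y] ranges over everything that does not involve the fresh
    sample; this expresses a vanishing conditional mean given the
    other draws. *)
Lemma sample_mean_eq0 Y : observable E Y ->
  (forall x, K x -> \int[distribution Pr U]_u chi x u = 0) ->
  \int[Pr]_w (Y w * chi (X w) (U w)) = 0.
Proof.
move=> mY chi0.
apply: (freezing_eq0 known_measurable innovation_independent
  (Phi := fun p => Y p.1 * chi (X p.1) p.2)) => [|w] /=.
  by apply: bmeasM => //; apply: (bmeas_comp (phi := fst)) mY.
rewrite meanZ ?(chi0 _ (X_in w)) ?mulr0//.
by split; [exact: chi_measurable|exists B => u; exact: chi_bounded].
Qed.

Lemma sample_observable E' : E `<=` E' -> E' i ->
  observable E' (fun w => chi (X w) (U w)).
Proof.
move=> EE' E'i; split; last by exists B => w; exact: chi_bounded.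
have mU := draw_known E'i FU.
apply: (@measurable_lipschitz_comp _ _ _ (Known E') K (fun x w => chi x (U w)) C) => //.
- by move=> x Kx; apply: measurableT_comp mU; exact: chi_measurable.
- by move=> x y w; exact: chi_lipschitz.
- by move=> c; case: (observable_rV_sub EE' X_observable c).
Qed.

End Sample.
End Innovation.

(** The encoded vector [X] and the test function [Y] are frozen while the seed
    [U] is integrated out. *)
Lemma rounding_error_mean_eq0 (U : {RV Pr >-> R}) i E d s
    (X : Omega -> 'rV[R]_d) c Y :
  F i = preimage_set_system setT U measurable -> ~ E i ->
  (forall A : set R, measurable A ->
     distribution Pr U A = uniform_prob (@ltr01 R) A) ->
  (0 < s)%N -> observable_rV E X -> observable E Y ->
  \int[Pr]_w (Y w * (Num.sg (X w 0 c) * `|X w| / s%:R *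
                     rounding_gap s (U w) (X w) c)) = 0.
Proof.
move=> FU iE Uunif s0 mX mY.
have ind A B : <<s family_events F E >> A -> measurable B ->
    (Pr (A `&` U @^-1` B) = Pr A * Pr (U @^-1` B))%E.
  move=> EA mB; apply: (independent_of_family _ _ _ _ iE) => //.
  by rewrite FU; exists B; rewrite ?setTI.
have mE : family_events F E `<=` measurable by exact: family_events_measurable.
apply: (freezing_eq0 mE ind (Phi := fun p => Y p.1 *
  (Num.sg (X p.1 0 c) * `|X p.1| / s%:R * rounding_gap s p.2 (X p.1) c))) => [|w] /=.
  apply: bmeasM; first by apply: (bmeas_comp (phi := fst)) mY.
  have mX1 : bounded_measurable_rV (fun p : Known E * R => X p.1).
    by move=> c'; apply: (bmeas_comp (phi := fst)) (mX c').
  exact: (bmeas_rounding_error (v := snd) c s0 _ mX1).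
under eq_Rintegral do rewrite mulrA.
rewrite meanZ.
  by rewrite /rounding_gap uniform_mean_lt ?mulr0// rounding_prob_itv ?ratio_itv.
split; last by exists 1 => v; exact: rounding_gap_le1.
by apply: (@measurable_rounding_gap _ _ _ _ s id (fun=> X w) c) => // c';
  exact: measurable_cst.
Qed.

End Observables.

(** * The error of one round *)

Section Round.
Context {R : realType} {dO} {Omega : measurableType dO} {M d q : nat}.
Variable Pr : probability Omega R.
Variables (z : nat -> 'I_M -> nat -> {RV Pr >-> q.-tuple R})
  (u1 : nat -> 'I_M -> 'I_d -> {RV Pr >-> R}) (u2 : nat -> 'I_d -> {RV Pr >-> R}).
Variable P : probability (q.-tuple R) R.
Hypothesis draws_iid : independent_draws z u1 u2 P.
Local Notation F := (draw_events z u1 u2).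
Local Notation sample t m j := (inl (inl (t, m, (j : nat))) : draw M d).
Local Notation worker_seed t m c := (inl (inr (t, m, c)) : draw M d).
Local Notation master_seed t c := (inr (t, c) : draw M d).
Local Notation Ex Y := (\int[Pr]_w Y w).

Lemma draw_events_measurable e : F e `<=` measurable.
Proof.
by case: e => [[[[t m] j]|[[t m] c]]|[t c]] _ [B mB <-]; rewrite setTI;
  exact: measurable_funPTI.
Qed.

Lemma draw_events_setI e : setI_closed (F e).
Proof.
by case: e => [[[[t m] j]|[[t m] c]]|[t c]] _ _ [A mA <-] [B mB <-];
  exists (A `&` B); rewrite ?setTI//; exact: measurableI.
Qed.

Lemma draw_events_setT e : F e setT.
Proof.
by case: e => [[[[t m] j]|[[t m] c]]|[t c]]; exists setT; rewrite ?setTI.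
Qed.

Definition before (t : nat) : set (draw M d) := [set e | (draw_round e < t)%N].

Lemma before_sub t t' : (t <= t')%N -> before t `<=` before t'.
Proof. by move=> tt' e /leq_trans; exact. Qed.

Lemma before_other t e : draw_round e = t -> before t `<=` [set~ e].
Proof. by move=> <- e'; rewrite /before /= => lt e'e; rewrite e'e ltnn in lt. Qed.

Section Estimate.
Variables (t n s1 s2 : nat) (v N : R).
Variables (W mu : Omega -> 'rV[R]_d) (Z : 'I_M -> nat -> Omega -> 'rV[R]_d).
Hypotheses (M_gt0 : (0 < M)%N) (n_gt0 : (0 < n)%N).
Hypotheses (s1_gt0 : (0 < s1)%N) (s2_gt0 : (0 < s2)%N).
Hypothesis W_past : observable_rV F (before t) W.
Hypothesis mu_past : observable_rV F (before t) mu.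
Hypothesis Z_known : forall m j,
  observable_rV F (before t `|` [set sample t m j]) (Z m j).
Hypothesis Z_unbiased : forall m j c Y,
  observable F [set~ sample t m j] Y ->
  Ex (fun w => Y w * (Z m j w 0 c - mu w 0 c)) = 0.
Hypothesis Z_variance : forall m j,
  Ex (fun w => dot (Z m j w - mu w) (Z m j w - mu w)) <= v.
Hypothesis Z_bounded : forall m j w, `|Z m j w| <= N.

Definition batch_mean m w := n%:R^-1 *: \sum_(j < n) Z m j w.
Definition aggregate w := M%:R^-1 *:
  \sum_(m < M) quantize s1 (fun c => u1 t m c w) (batch_mean m w).
Definition decoded w := quantize s2 (fun c => u2 t c w) (aggregate w).

Let sampled : set (draw M d) :=
  before t `|` [set e | exists m j, e = sample t m j].
Let encoded : set (draw M d) :=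
  sampled `|` [set e | exists m c, e = worker_seed t m c].

Let batch_mean_known m : observable_rV F sampled (batch_mean m).
Proof.
apply: bmeas_rVZ; apply: bmeas_rV_sum => j.
apply: observable_rV_sub (Z_known m j) => e [|->]; first by left.
by right; exists m, j.
Qed.

Let batch_mean_bounded m w : `|batch_mean m w| <= N.
Proof.
rewrite /batch_mean normrZ normfV normr_nat ler_pdivrMl ?ltr0n//.
rewrite mulr_natl -[X in _ *+ X]card_ord -sumr_const.
by rewrite (le_trans (ler_norm_sum _ _ _))// ler_sum.
Qed.

Let worker_seed_measurable E m c : E (worker_seed t m c) ->
  measurable_fun setT
    (u1 t m c : g_sigma_algebraType (family_events F E) -> R).
Proof. by move=> Ec; exact: draw_known Ec _. Qed.

Let master_seed_measurable E c : E (master_seed t c) ->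
  measurable_fun setT
    (u2 t c : g_sigma_algebraType (family_events F E) -> R).
Proof. by move=> Ec; exact: draw_known Ec _. Qed.

Let aggregate_known : observable_rV F encoded aggregate.
Proof.
apply: bmeas_rVZ; apply: bmeas_rV_sum => m.
apply: (bmeas_quantize s1_gt0).
  by move=> c; apply: worker_seed_measurable; right; exists m, c.
by apply: observable_rV_sub (batch_mean_known m) => e; left.
Qed.

Let aggregate_bounded w : `|aggregate w| <= N.
Proof.
rewrite /aggregate normrZ normfV normr_nat ler_pdivrMl ?ltr0n//.
rewrite mulr_natl -[X in _ *+ X]card_ord -sumr_const.
rewrite (le_trans (ler_norm_sum _ _ _))// ler_sum// => m _.
by rewrite (le_trans (norm_quantize_le _ _ s1_gt0)).
Qed.

Let decoded_known : observable_rV F (before t.+1) decoded.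
Proof.
apply: (bmeas_quantize s2_gt0).
  by move=> c; apply: master_seed_measurable; exact: ltnSn.
apply: observable_rV_sub aggregate_known => e [[be|[m [j ->]]]|[m [c ->]]].
- exact: before_sub (leqnSn t) _ be.
- exact: ltnSn.
- exact: ltnSn.
Qed.

Lemma round_error_known :
  observable_rV F (before t.+1) (fun w => W w + decoded w - mu w).
Proof.
apply: bmeas_rVB; last exact: observable_rV_sub (before_sub (leqnSn t)) mu_past.
apply: bmeas_rVD => //.
exact: observable_rV_sub (before_sub (leqnSn t)) W_past.
Qed.

Let sampling_error c (mj : 'I_M * 'I_n) w :=
  (M%:R * n%:R)^-1 * (Z mj.1 mj.2 w 0 c - mu w 0 c).
Let worker_error c m w := M%:R^-1 *
  (Num.sg (batch_mean m w 0 c) * `|batch_mean m w| / s1%:R *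
   rounding_gap s1 (u1 t m c w) (batch_mean m w) c).
Let master_error c w :=
  Num.sg (aggregate w 0 c) * `|aggregate w| / s2%:R *
  rounding_gap s2 (u2 t c w) (aggregate w) c.

Let error_decomposition c w :
  (W w + decoded w - mu w) 0 c =
  W w 0 c + \sum_mj sampling_error c mj w + \sum_m worker_error c m w +
  master_error c w.
Proof.
have aggregateE : aggregate w 0 c = \sum_m worker_error c m w +
    M%:R^-1 * \sum_m n%:R^-1 * \sum_(j < n) Z m j w 0 c.
  rewrite /aggregate mxE summxE /worker_error -[X in X + _]mulr_sumr -mulrDr -big_split /=.
  congr (_ * _); apply: eq_bigr => m _; rewrite quantizeE// addrC; congr (_ + _).
  by rewrite mxE summxE.
have samplingE : \sum_mj sampling_error c mj w =
    M%:R^-1 * (\sum_m n%:R^-1 * \sum_(j < n) Z m j w 0 c) - mu w 0 c.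
  rewrite /sampling_error -mulr_sumr sumrB.
  rewrite -(pair_big xpredT xpredT (fun m (j : 'I_n) => Z m j w 0 c)) /=.
  rewrite sumr_const card_prod !card_ord mulrBr -mulr_sumr invfM mulrA.
  congr (_ - _); rewrite -[mu w 0 c *+ _]mulr_natr natrM.
  by field; rewrite !pnatr_eq0 -!lt0n M_gt0 n_gt0.
rewrite samplingE [LHS]mxE [X in X + _]mxE [X in _ + X]mxE quantizeE//.
rewrite -/(master_error c w) aggregateE; ring.
Qed.

Let sampling_error_known c (mj : 'I_M * 'I_n) : observable F
  (before t `|` [set sample t mj.1 mj.2]) (sampling_error c mj).
Proof.
apply: bmeasZ; apply: bmeasB; first exact: Z_known.
by apply: observable_sub (mu_past c); left.
Qed.

Let worker_error_known c m : observable F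
  (sampled `|` [set worker_seed t m c]) (worker_error c m).
Proof.
apply/bmeasZ/bmeas_rounding_error => //.
  by apply: worker_seed_measurable; right.
by apply: observable_rV_sub (batch_mean_known m); left.
Qed.

Let master_error_known c : observable F (before t.+1) (master_error c).
Proof.
apply: bmeas_rounding_error => //.
  by apply: master_seed_measurable; exact: ltnSn.
apply: observable_rV_sub aggregate_known => e [[be|[m [j ->]]]|[m [c' ->]]].
- exact: before_sub (leqnSn t) _ be.
- exact: ltnSn.
- exact: ltnSn.
Qed.

Let draws_bmeas E (Y : Omega -> R) : observable F E Y -> bounded_measurable Y.
Proof. by apply: observable_bmeas; exact: draw_events_measurable. Qed.

Let sampling_error_orthogonal c (mj : 'I_M * 'I_n) (Y : Omega -> R) :
  observable F [set~ sample t mj.1 mj.2] Y ->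
  Ex (fun w => Y w * sampling_error c mj w) = 0.
Proof.
move=> mY; rewrite -(Z_unbiased c (bmeasZ (M%:R * n%:R)^-1 mY)).
by apply: eq_Rintegral => w _; rewrite /sampling_error mulrA [Y w * _]mulrC.
Qed.

Let worker_error_orthogonal c m (Y : Omega -> R) :
  observable F [set~ worker_seed t m c] Y ->
  Ex (fun w => Y w * worker_error c m w) = 0.
Proof.
move=> mY; rewrite -(@rounding_error_mean_eq0 _ _ _ _ Pr F draw_events_measurable
  draw_events_setI draw_events_setT (draws_independent draws_iid) (u1 t m c)
  (worker_seed t m c) [set~ worker_seed t m c] d s1 (batch_mean m) c
  (fun w => M%:R^-1 * Y w)) //.
- by apply: eq_Rintegral => w _; rewrite /worker_error mulrA [Y w * _]mulrC.
- by move=> /(_ erefl).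
- exact: worker_seed_law draws_iid t m c.
- apply: observable_rV_sub (batch_mean_known m) => e [|[m' [j ->]]] //.
  exact: before_other.
- exact: bmeasZ.
Qed.

Let master_error_orthogonal c (Y : Omega -> R) :
  observable F [set~ master_seed t c] Y ->
  Ex (fun w => Y w * master_error c w) = 0.
Proof.
move=> mY; apply: (@rounding_error_mean_eq0 _ _ _ _ Pr F draw_events_measurable
  draw_events_setI draw_events_setT (draws_independent draws_iid) (u2 t c)
  (master_seed t c) [set~ master_seed t c] d s2 aggregate c) => //.
- by move=> /(_ erefl).
- exact: master_seed_law draws_iid t c.
- apply: observable_rV_sub aggregate_known => e [[|[m' [j ->]]]|[m [c' ->]]] //.
  exact: before_other.
Qed.

(** The contributions are added in the order in which they arise.  A contribution
    is orthogonal to all earlier ones because the draw that causes it does not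
    enter them. *)
Let coordinate_error_sqr c :
  Ex (fun w => (W w + decoded w - mu w) 0 c ^+ 2) =
  Ex (fun w => W w 0 c ^+ 2) +
  \sum_mj Ex (fun w => sampling_error c mj w ^+ 2) +
  \sum_m Ex (fun w => worker_error c m w ^+ 2) +
  Ex (fun w => master_error c w ^+ 2).
Proof.
have oW : observable F sampled (fun w => W w 0 c).
  by apply: observable_sub (W_past c); left.
have oS mj : observable F sampled (sampling_error c mj).
  apply: observable_sub (sampling_error_known c mj) => e [|->]; first by left.
  by right; exists mj.1, mj.2.
have oWS : observable F sampled
    (fun w => W w 0 c + \sum_mj sampling_error c mj w).
  by apply: bmeasD => //; exact: bmeas_sum.
have sampled_other m c' : sampled `<=` [set~ worker_seed t m c'].
  by move=> e [|[m' [j ->]]] //; exact: before_other.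
have oV m c' : observable F encoded (worker_error c' m).
  apply: observable_sub (worker_error_known c' m) => e [|->]; first by left.
  by right; exists m, c'.
have encoded_other c' : encoded `<=` [set~ master_seed t c'].
  by move=> e [[|[m' [j ->]]]|[m' [c'' ->]]] //; exact: before_other.
(* The errors after the sampling and after the encoding by the workers. *)
pose V1 w := W w 0 c + \sum_mj sampling_error c mj w.
pose V2 w := V1 w + \sum_m worker_error c m w.
have oV2 : observable F encoded V2.
  apply: bmeasD; first by apply: observable_sub oWS; left.
  by apply: bmeas_sum => m; exact: oV.
transitivity (Ex (fun w => (V2 w + \sum_(i <- [:: tt]) master_error c w) ^+ 2)).
  by apply: eq_Rintegral => w _; rewrite error_decomposition big_seq1.
rewrite (mean_sqr_orthogonal (W := V2) (a := fun=> master_error c))//.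
- rewrite big_seq1; congr (_ + _).
  rewrite (mean_sqr_orthogonal (W := V1) (a := worker_error c))//.
  + congr (_ + _); rewrite (mean_sqr_orthogonal (W := fun w => W w 0 c)
      (a := sampling_error c)) ?index_enum_uniq//.
    * exact: draws_bmeas oW.
    * by move=> mj; exact: draws_bmeas (oS mj).
    * move=> mj _; apply: sampling_error_orthogonal.
      by apply: observable_sub (W_past c); exact: before_other.
    * move=> mj mj' _ _ mjN; apply: sampling_error_orthogonal.
      apply: observable_sub (sampling_error_known c mj) => e [|-> [em ej]].
        exact: before_other.
      by case/eqP: mjN; rewrite [mj]surjective_pairing em (val_inj ej) -surjective_pairing.
  + exact: draws_bmeas oWS.
  + by move=> m; exact: draws_bmeas (oV m c).
  + exact: index_enum_uniq.
  + move=> m _; apply: worker_error_orthogonal.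
    exact: observable_sub oWS.
  + move=> m m' _ _ mN; apply: worker_error_orthogonal.
    apply: observable_sub (worker_error_known c m) => e [|-> [em]].
      exact: sampled_other.
    by rewrite em eqxx in mN.
- exact: draws_bmeas oV2.
- by move=> _; exact: draws_bmeas (master_error_known c).
- move=> [] _; apply: master_error_orthogonal.
  exact: observable_sub oV2.
Qed.

(** Bounds the error after one round, abstractly: [W] is the error inherited from
    the previous round of the period (zero in its first round), [mu] the true
    vector, a gradient or a difference of gradients, and [Z m j] its unbiased
    sample by worker m.  Averaging over M workers and n samples divides the
    variance by M n; averaging over workers divides the rounding error of the
    workers by M, but not that of the master. *)
Lemma round_error_sqr :
  Ex (fun w => dot (W w + decoded w - mu w) (W w + decoded w - mu w)) <=
  Ex (fun w => dot (W w) (W w)) + v / (M%:R * n%:R)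
  + d%:R * N ^+ 2 / (M%:R * s1%:R ^+ 2) + d%:R * N ^+ 2 / s2%:R ^+ 2.
Proof.
have Mn_gt0 : 0 < M%:R * n%:R :> R by rewrite mulr_gt0 ?ltr0n.
have N_ge0 : 0 <= N.
  by apply: le_trans (Z_bounded (Ordinal M_gt0) 0%N point).
have mean_dot X : bounded_measurable_rV X ->
    Ex (fun w => dot (X w) (X w)) = \sum_c Ex (fun w => X w 0 c ^+ 2).
  by move=> mX; rewrite mean_sum// => c; under eq_fun do rewrite -expr2;
    exact: bmeasX.
have bS c mj : bounded_measurable (sampling_error c mj).
  exact: draws_bmeas (sampling_error_known c mj).
have bV c m : bounded_measurable (worker_error c m).
  exact: draws_bmeas (worker_error_known c m).
have bU c : bounded_measurable (master_error c).
  exact: draws_bmeas (master_error_known c).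
have bsqr Y : bounded_measurable Y -> bounded_measurable (fun w => Y w ^+ 2).
  exact: bmeasX.
rewrite mean_dot; last by move=> c; exact: draws_bmeas (round_error_known c).
rewrite mean_dot; last by move=> c; exact: draws_bmeas (W_past c).
under eq_bigr do rewrite coordinate_error_sqr.
rewrite !big_split /=; apply: lerD; first apply: lerD; first apply: lerD => //.
- rewrite exchange_big /=.
  apply: (@le_trans _ _ (\sum_(mj : 'I_M * 'I_n) (M%:R * n%:R) ^- 2 * v)).
    apply: ler_sum => mj _; rewrite -mean_sum; last by move=> c; exact: bsqr.
    rewrite -exprVn.
    have -> : Ex (fun w => \sum_c sampling_error c mj w ^+ 2) =
        (M%:R * n%:R)^-1 ^+ 2 *
        Ex (fun w => dot (Z mj.1 mj.2 w - mu w) (Z mj.1 mj.2 w - mu w)).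
      have mZ : bounded_measurable_rV (fun w => Z mj.1 mj.2 w - mu w).
        apply: bmeas_rVB => c; first exact: draws_bmeas (Z_known _ _ c).
        exact: draws_bmeas (mu_past c).
      rewrite -meanZ; last exact: bmeas_dot.
      apply: eq_Rintegral => w _; rewrite mulr_sumr; apply: eq_bigr => c _.
      by rewrite exprMn !mxE expr2.
    by rewrite ler_wpM2l// sqr_ge0.
  rewrite sumr_const card_prod !card_ord -[_ *+ _]mulr_natl natrM.
  have M0 : M%:R != 0 :> R by rewrite pnatr_eq0 -lt0n.
  have n0 : n%:R != 0 :> R by rewrite pnatr_eq0 -lt0n.
  apply: eqr_le; field.
  by rewrite M0 n0.
- apply: (@le_trans _ _ (\sum_(c < d) \sum_(m < M) (N / (M%:R * s1%:R)) ^+ 2)).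
    apply: ler_sum => c _; apply: ler_sum => m _.
    rewrite -[leRHS](mean_cst Pr); apply: le_mean; [exact: bsqr|exact: bmeas_cst|].
    move=> w; rewrite -real_normK ?num_real// lerXn2r ?nnegrE//.
      by rewrite divr_ge0 ?mulr_ge0.
    have := quantize_error_le (fun c => u1 t m c w) (batch_mean m w) c s1_gt0.
    rewrite quantizeE// addrC addKr => error_le.
    rewrite /worker_error normrM normfV normr_nat invfM mulrCA.
    rewrite ler_wpM2l ?invr_ge0// (le_trans error_le)//.
    by rewrite ler_wpM2r ?invr_ge0.
  rewrite !sumr_const !card_ord -[_ *+ d]mulr_natl -[_ *+ M]mulr_natl.
  have M0 : M%:R != 0 :> R by rewrite pnatr_eq0 -lt0n.
  have s0 : s1%:R != 0 :> R by rewrite pnatr_eq0 -lt0n.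
  apply: eqr_le; field.
  by rewrite M0 s0.
- apply: (@le_trans _ _ (\sum_(c < d) (N / s2%:R) ^+ 2)).
    apply: ler_sum => c _.
    rewrite -[leRHS](mean_cst Pr); apply: le_mean; [exact: bsqr|exact: bmeas_cst|].
    move=> w; rewrite -real_normK ?num_real// lerXn2r ?nnegrE//.
      by rewrite divr_ge0.
    have := quantize_error_le (fun c => u2 t c w) (aggregate w) c s2_gt0.
    rewrite quantizeE// addrC addKr => error_le.
    by rewrite (le_trans error_le)// ler_wpM2r ?invr_ge0.
  by rewrite sumr_const card_ord -[leLHS]mulr_natl exprMn exprVn mulrA.
Qed.

End Estimate.
End Round.

(** * Smooth convex functions along segments *)

Section Segments.
Context {R : realType} {d : nat}.
Implicit Types (K : set 'rV[R]_d) (g : 'rV[R]_d -> R) (x y h : 'rV[R]_d).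

Lemma convex_set_segment K x y (s : R) : convex_set K -> K x -> K y ->
  0 <= s <= 1 -> K (x + s *: (y - x)).
Proof.
move=> cK Kx Ky /andP[s0 s1].
have := cK y x (Itv01 s0 s1) (mem_set Ky) (mem_set Kx); rewrite inE.
suff -> : x + s *: (y - x) = s *: y + (1 - s) *: x by [].
by rewrite scalerBr scalerBl scale1r addrC addrAC addrA.
Qed.

Lemma derive_grad g x h : differentiable g x -> 'D_h g x = dot (grad g x) h.
Proof.
move=> dg; rewrite deriveE// {1}(row_sum_delta h) linear_sum /=.
by apply: eq_bigr => c _; rewrite linearZ /= mxE deriveE// mulrC.
Qed.

Lemma is_derive_segment g x h (s : R) : differentiable g (x + s *: h) ->
  is_derive s 1 (fun r => g (x + r *: h)) (dot (grad g (x + s *: h)) h).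
Proof.
move=> dg; rewrite -derive_grad//.
have shiftE : (fun r : R => r^-1 *: (((fun r => g (x + r *: h)) \o shift s) (r *: 1)
      - g (x + s *: h))) =
    (fun r : R => r^-1 *: ((g \o shift (x + s *: h)) (r *: h) - g (x + s *: h))).
  apply/funext => r /=; congr (_ *: (g _ - _)).
  by rewrite scaler1 scalerDl addrCA.
split; first by rewrite /derivable shiftE; exact: diff_derivable.
by rewrite /derive shiftE.
Qed.

Lemma mvt_segment K g x y : convex_set K -> (forall x, K x -> differentiable g x) ->
  K x -> K y -> exists2 s : R, 0 <= s <= 1 &
    g y - g x = dot (grad g (x + s *: (y - x))) (y - x).
Proof.
move=> cK dg Kx Ky.
have seg (s : R) : s \in `[0, 1] -> K (x + s *: (y - x)).
  by rewrite in_itv /=; exact: convex_set_segment.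
have dseg (s : R) : s \in `[0, 1] -> is_derive s 1 (fun r => g (x + r *: (y - x)))
    (dot (grad g (x + s *: (y - x))) (y - x)).
  by move=> s01; apply: is_derive_segment; exact/dg/seg.
pose phi (r : R) := g (x + r *: (y - x)).
pose dphi (r : R) := dot (grad g (x + r *: (y - x))) (y - x).
have dphiP (s : R) : s \in `]0, 1[ -> is_derive s 1 phi (dphi s).
  by move=> s01; apply: dseg; exact: subset_itv_oo_cc.
have cphi : {within `[0, 1], continuous phi}.
  apply: derivable_within_continuous => s s01.
  by have := dseg s s01; case.
have [s s01] := MVT_segment ler01 dphiP cphi.
have -> : phi 1 = g y by rewrite /phi scale1r addrC subrK.
have -> : phi 0 = g x by rewrite /phi scale0r addr0.
rewrite subr0 mulr1 => gE.
by exists s; rewrite // -in_itv.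
Qed.

Lemma smooth_segment K g (L : R) x y s : convex_set K -> smooth_on K L g -> 0 <= L ->
  K x -> K y -> 0 <= s <= 1 ->
  `|dot (grad g (x + s *: (y - x)) - grad g x) (y - x)| <= L * enorm (y - x) ^+ 2.
Proof.
move=> cK [dg lg] L0 Kx Ky s01; have /andP[s0 s1] := s01.
set w := x + _; have Kw : K w by exact: convex_set_segment.
have lw : enorm (grad g w - grad g x) <= L * enorm (y - x).
  rewrite (le_trans (lg _ _ Kw Kx))// ler_wpM2l// /w addrC addKr enormZ.
  by rewrite ger0_norm// ler_piMl// enorm_ge0.
rewrite expr2 mulrA.
have wpos : enorm (grad g w - grad g x) * enorm (y - x) <=
    L * enorm (y - x) * enorm (y - x) by rewrite ler_wpM2r// enorm_ge0.
rewrite ler_norml; apply/andP; split; last exact: le_trans (cauchy_schwarz _ _) _.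
rewrite lerNl -mulN1r -dotZl (le_trans (cauchy_schwarz _ _))// enormZ.
by rewrite normrN1 mul1r.
Qed.

(** The constant L, instead of the optimal L / 2, is what a single application of
    the mean value theorem yields. *)
Lemma smooth_upper K g (L : R) x y : convex_set K -> smooth_on K L g -> 0 <= L ->
  K x -> K y -> g y <= g x + dot (grad g x) (y - x) + L * enorm (y - x) ^+ 2.
Proof.
move=> cK sg L0 Kx Ky; have [dg _] := sg.
have [s s01 gE] := mvt_segment cK dg Kx Ky.
have := smooth_segment cK sg L0 Kx Ky s01; rewrite dotBl -gE.
by move=> /(le_trans (ler_norm _)); lra.
Qed.

Lemma smooth_lower K g (L : R) x y : convex_set K -> smooth_on K L g -> 0 <= L ->
  K x -> K y -> g x + dot (grad g x) (y - x) - L * enorm (y - x) ^+ 2 <= g y.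
Proof.
move=> cK sg L0 Kx Ky; have [dg _] := sg.
have [s s01 gE] := mvt_segment cK dg Kx Ky.
have := smooth_segment cK sg L0 Kx Ky s01; rewrite dotBl -gE ler_norml => /andP[].
lra.
Qed.

(** Compare convexity and smoothness at x + s (y - x), divide by s, and take s
    small. *)
Lemma convex_gradient K g (L : R) x y : convex_set K -> smooth_on K L g -> 0 <= L ->
  K x -> K y ->
  (forall s, 0 <= s <= 1 -> g (x + s *: (y - x)) <= g x + s * (g y - g x)) ->
  dot (grad g x) (y - x) <= g y - g x.
Proof.
move=> cK sg L0 Kx Ky cg; apply/ler_addgt0Pr => e e0.
set C := L * enorm (y - x) ^+ 2.
have C0 : 0 <= C by rewrite mulr_ge0// sqr_ge0.
(* With this s, the quadratic term s C of the comparison is at most e. *)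
pose s := e / (e + C).
have eC : 0 < e + C by rewrite ltr_wpDr.
have s0 : 0 < s by rewrite divr_gt0.
have s1 : s <= 1 by rewrite ler_pdivrMr// mul1r lerDl.
have s01 : 0 <= s <= 1 by rewrite ltW.
have Kz := convex_set_segment cK Kx Ky s01.
have zx : x + s *: (y - x) - x = s *: (y - x) by rewrite addrC addKr.
have := smooth_lower cK sg L0 Kx Kz; rewrite zx dotZr enormZ exprMn.
rewrite real_normK ?num_real// => low; have up := cg s s01.
have sC : s * C <= e by rewrite mulrAC ler_pdivrMr// mulrDr lerDr mulr_ge0// ltW.
rewrite -(ler_pM2l s0).
move: low.
have -> : L * (s ^+ 2 * enorm (y - x) ^+ 2) = s * (s * C) by rewrite /C; ring.
have : s * (s * C) <= s * e by rewrite ler_pM2l.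
rewrite mulrDr mulrBr; lra.
Qed.

Lemma compact_diameter K x y : compact K -> K x -> K y -> enorm (x - y) <= diameter K.
Proof.
move=> cK Kx Ky; apply: ub_le_sup; last by exists (x, y).
have [B [_ KB]] := compact_bounded cK.
exists (d%:R * (`|B| + 1 + (`|B| + 1))) => _ [[a b] /= [Ka Kb] <-].
rewrite (le_trans (enorm_le_norm _))// ler_wpM2l// (le_trans (ler_normB _ _))//.
by rewrite lerD// KB// ltr_pwDr// ler_norm.
Qed.

End Segments.

(** * Consequences of the assumptions on the problem *)

Section StochasticProblem.
Context {R : realType} {d q : nat}.
Variables (K : set 'rV[R]_d) (P : probability (q.-tuple R) R).
Variables (ft : 'rV[R]_d -> q.-tuple R -> R) (f : 'rV[R]_d -> R).
Variables (L D Ginf sigma : R).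
Hypothesis L_gt0 : 0 < L.
Hypothesis problem : stochastic_problem K P ft f L D Ginf sigma.
Local Notation Gt x z := (grad (ft^~ z) x).

Lemma problem_mean x : K x -> f x = \int[P]_z ft x z.
Proof.
move=> Kx; have := f_expectation problem Kx.
by rewrite unlock /Rintegral => ->.
Qed.

Lemma gradient_mean x c : K x -> grad f x 0 c = \int[P]_z Gt x z 0 c.
Proof.
move=> Kx; have := grad_unbiased problem c Kx.
by rewrite unlock /Rintegral => ->.
Qed.

Lemma sample_gradient_coord_le x z c : K x -> `|Gt x z 0 c| <= Ginf.
Proof.
by move=> Kx; rewrite (le_trans (coord_le_norm _ _))// (grad_bounded problem).
Qed.

Lemma bmeas_sample_gradient x : K x -> bounded_measurable_rV (fun z => Gt x z).
Proof.
move=> Kx c; split; first exact: grad_measurable problem _ _ Kx.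
by exists Ginf => z; exact: sample_gradient_coord_le.
Qed.

Lemma gradient_coord_le x c : K x -> `|grad f x 0 c| <= Ginf.
Proof.
move=> Kx; rewrite gradient_mean// ler_norml; have bG := bmeas_sample_gradient Kx c.
apply/andP; split.
  rewrite -[leLHS](mean_cst P); apply: le_mean => //; first exact: bmeas_cst.
  by move=> z; have := sample_gradient_coord_le z c Kx; rewrite ler_norml => /andP[].
rewrite -[leRHS](mean_cst P); apply: le_mean => //; first exact: bmeas_cst.
by move=> z; have := sample_gradient_coord_le z c Kx; rewrite ler_norml => /andP[].
Qed.

Lemma sample_gradient_lipschitz x y z : K x -> K y ->
  enorm (Gt x z - Gt y z) <= L * enorm (x - y).
Proof. by move=> Kx Ky; have [_] := ft_smooth problem z; exact. Qed.

(** Smoothness passes from the sample functions to their mean: with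
    u = grad f x - grad f y, the square |u|^2 is the mean of the inner products
    of u with differences of sample gradients, each at most |u| L |x - y|. *)
Lemma problem_smooth : smooth_on K L f.
Proof.
split; first exact: f_differentiable problem.
move=> x y Kx Ky; set u := grad f x - grad f y.
have bxy : bounded_measurable_rV (fun z => Gt x z - Gt y z).
  by apply: bmeas_rVB; exact: bmeas_sample_gradient.
have uE : dot u u = \int[P]_z dot u (Gt x z - Gt y z).
  rewrite /dot mean_sum; last by move=> c; apply: bmeasM (bxy c); exact: bmeas_cst.
  apply: eq_bigr => c _; rewrite meanZ//; congr (_ * _).
  rewrite {1}/u rV_subE !gradient_mean// -meanB; try exact: bmeas_sample_gradient.
  by apply: eq_Rintegral => z _; rewrite rV_subE.
have : dot u u <= enorm u * (L * enorm (x - y)).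
  rewrite uE -[leRHS](mean_cst P); apply: le_mean; [|exact: bmeas_cst|].
    by apply: bmeas_dot => //; exact: bmeas_rV_cst.
  move=> z; rewrite (le_trans (cauchy_schwarz _ _))// ler_wpM2l ?enorm_ge0//.
  exact: sample_gradient_lipschitz.
have [->|u0] := eqVneq (enorm u) 0.
  by move=> _; rewrite mulr_ge0 ?enorm_ge0// ltW.
by rewrite -enorm_sqr expr2 ler_pM2l// lt0r u0 enorm_ge0.
Qed.

Lemma problem_convex x y s : K x -> K y -> 0 <= s <= 1 ->
  f (x + s *: (y - x)) <= f x + s * (f y - f x).
Proof.
move=> Kx Ky s01; have /andP[s0 s1] := s01; set w := x + _.
have Kw : K w by apply: convex_set_segment => //; exact: domain_convex problem.
have int v : K v -> P.-integrable setT (EFin \o ft v).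
  exact: ft_integrable problem v.
have intZ a v : K v -> P.-integrable setT (EFin \o (fun z => a * ft v z)).
  move=> Kv; rewrite (_ : EFin \o _ = (fun z => a%:E * (EFin \o ft v) z)%E).
    by apply: integrableZl => //; exact: int.
  by apply/funext => z /=; rewrite EFinM.
have -> : f x + s * (f y - f x) = \int[P]_z (s * ft y z + (1 - s) * ft x z).
  rewrite RintegralD//; [|exact: intZ..].
  by rewrite !RintegralZl//; [rewrite -!problem_mean//; ring|exact: int..].
rewrite problem_mean//; apply: le_Rintegral => //; first exact: int.
  rewrite (_ : EFin \o _ = (EFin \o (fun z => s * ft y z)) \+
      (EFin \o (fun z => (1 - s) * ft x z))).
    by apply: integrableD => //; exact: intZ.
  by apply/funext => z.
move=> z _.
have := ft_convex problem z (Itv01 s0 s1) (mem_set Ky) (mem_set Kx).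
suff -> : w = s *: y + (1 - s) *: x by [].
by rewrite /w scalerBr scalerBl scale1r addrC addrAC addrA.
Qed.

Lemma problem_gradient_lower x y : K x -> K y ->
  dot (grad f x) (y - x) <= f y - f x.
Proof.
move=> Kx Ky; apply: (convex_gradient (domain_convex problem) problem_smooth) => //.
  exact: ltW.
by move=> s; exact: problem_convex.
Qed.

Lemma batch_gradient n zs x : K x ->
  grad (batch_fun ft n zs) x = n%:R^-1 *: \sum_(j < n) Gt x (zs j).
Proof.
move=> Kx; apply/rowP => c; rewrite !mxE summxE.
have dft (j : 'I_n) : derivable (ft^~ (zs j)) x (delta_mx 0 c).
  by apply: diff_derivable; have [dft _] := ft_smooth problem (zs j); exact: dft.
have -> : batch_fun ft n zs = n%:R^-1 \*: \sum_(j < n) (ft^~ (zs j)).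
  by apply/funext => y; rewrite /batch_fun /= fct_sumE.
rewrite deriveZ; last exact: derivable_sum.
rewrite derive_sum//; congr (_ * _).
by apply: eq_bigr => j _; rewrite mxE.
Qed.

Definition gradient_noise x z : 'rV[R]_d := Gt x z - grad f x.

Lemma bmeas_gradient_noise x : K x -> bounded_measurable_rV (gradient_noise x).
Proof.
by move=> Kx; apply: bmeas_rVB; [exact: bmeas_sample_gradient|exact: bmeas_rV_cst].
Qed.

Lemma gradient_noise_coord_le x z c : K x ->
  `|gradient_noise x z 0 c| <= 2 * Ginf.
Proof.
move=> Kx; rewrite rV_subE (le_trans (ler_normB _ _))// mulr_natl mulr2n lerD//.
  exact: sample_gradient_coord_le.
exact: gradient_coord_le.
Qed.

Lemma gradient_noise_mean_eq0 x c : K x ->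
  \int[P]_z gradient_noise x z 0 c = 0.
Proof.
move=> Kx; under eq_Rintegral do rewrite rV_subE.
rewrite meanB; [|exact: bmeas_sample_gradient|exact: bmeas_cst].
by rewrite mean_cst -gradient_mean// subrr.
Qed.

Lemma gradient_noise_variance x : K x ->
  \int[P]_z dot (gradient_noise x z) (gradient_noise x z) <= sigma ^+ 2.
Proof.
move=> Kx; have := grad_variance problem Kx; rewrite unlock.
under eq_integral do rewrite enorm_sqr.
by rewrite EFin_mean ?lee_fin//; apply: bmeas_dot; exact: bmeas_gradient_noise.
Qed.

Lemma gradient_noise_lipschitz x y z c : K x -> K y ->
  `|gradient_noise x z 0 c - gradient_noise y z 0 c| <= 2 * L * d%:R * `|x - y|.
Proof.
move=> Kx Ky.
have -> : gradient_noise x z 0 c - gradient_noise y z 0 c =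
    (Gt x z - Gt y z) 0 c - (grad f x - grad f y) 0 c by rewrite !rV_subE; ring.
have Lxy : L * enorm (x - y) <= L * d%:R * `|x - y|.
  by rewrite -mulrA ler_pM2l// enorm_le_norm.
have h1 := le_trans (coord_le_enorm (Gt x z - Gt y z) c)
  (le_trans (sample_gradient_lipschitz z Kx Ky) Lxy).
have h2 := le_trans (coord_le_enorm (grad f x - grad f y) c)
  (le_trans (proj2 problem_smooth _ _ Kx Ky) Lxy).
rewrite (le_trans (ler_normB _ _))// (le_trans (lerD h1 h2))//.
by rewrite -mulr2n -[leLHS]mulr_natl !mulrA.
Qed.

Lemma sqr_gradient_noise_lipschitz x y z : K x -> K y ->
  dot (gradient_noise x z) (gradient_noise x z) -
  dot (gradient_noise y z) (gradient_noise y z) <=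
  d%:R * (2 * L * d%:R * (4 * Ginf)) * `|x - y|.
Proof.
move=> Kx Ky; rewrite /dot -sumrB.
apply: (@le_trans _ _ (\sum_(c < d) 2 * L * d%:R * (4 * Ginf) * `|x - y|)).
  apply: ler_sum => c _; set a := gradient_noise x z 0 c; set b := gradient_noise y z 0 c.
  have -> : a * a - b * b = (a - b) * (a + b) by ring.
  rewrite (le_trans (ler_norm _))// normrM [leRHS]mulrAC ler_pM//.
    exact: gradient_noise_lipschitz.
  rewrite (le_trans (ler_normD _ _))//.
  have := gradient_noise_coord_le z c Kx; have := gradient_noise_coord_le z c Ky.
  rewrite -/a -/b; lra.
by rewrite sumr_const card_ord -[_ *+ _]mulr_natl !mulrA.
Qed.

Lemma sqr_gradient_noise_bounded x z : K x ->
  `|dot (gradient_noise x z) (gradient_noise x z)| <= d%:R * (2 * Ginf) ^+ 2.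
Proof.
move=> Kx; rewrite ger0_norm ?dot_ge0// mulr_natl -[X in _ *+ X]card_ord -sumr_const.
apply: ler_sum => c _; rewrite -expr2 -real_normK ?num_real//.
have := gradient_noise_coord_le z c Kx => h.
by rewrite lerXn2r ?nnegrE// (le_trans _ h).
Qed.

Lemma domain_distance_le x y : K x -> K y -> enorm (x - y) <= D.
Proof.
move=> Kx Ky; rewrite (domain_diameter problem).
exact: compact_diameter (domain_compact problem) Kx Ky.
Qed.

Lemma problem_minimizer x : K x -> exists xmin, argmin K f xmin.
Proof.
move=> Kx; have [|||y /set_mem Ky fy] := @compact_EVT_min _ R f K.
- by exists x.
- exact: domain_compact problem.
- apply: continuous_in_subspaceT => y /set_mem Ky.
  exact/differentiable_continuous/(f_differentiable problem).
exists y; split => // w Kw; exact/fy/mem_set.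
Qed.

End StochasticProblem.

(** * Functions of a random iterate *)

Section RandomIterates.
Context {R : realType} {d q M : nat} {dO} {Omega : measurableType dO}.
Variables (K : set 'rV[R]_d) (P : probability (q.-tuple R) R).
Variables (ft : 'rV[R]_d -> q.-tuple R -> R) (f : 'rV[R]_d -> R).
Variables (L D Ginf sigma : R) (Pr : probability Omega R).
Variables (z : nat -> 'I_M -> nat -> {RV Pr >-> q.-tuple R})
  (u1 : nat -> 'I_M -> 'I_d -> {RV Pr >-> R}) (u2 : nat -> 'I_d -> {RV Pr >-> R}).
Hypothesis L_gt0 : 0 < L.
Hypothesis problem : stochastic_problem K P ft f L D Ginf sigma.
Hypothesis draws_iid : independent_draws z u1 u2 P.
Local Notation F := (draw_events z u1 u2).
Local Notation sample t m j := (inl (inl (t, m, (j : nat))) : draw M d).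
Local Notation Ex Y := (\int[Pr]_w Y w).
Local Notation Gt x z := (grad (ft^~ z) x).
Local Notation noise := (gradient_noise ft f).

Let K_compact : compact K. Proof. exact: domain_compact problem. Qed.

Lemma observable_rV_in E (X : Omega -> 'rV[R]_d) : (forall w, K (X w)) ->
  (forall c, measurable_fun setT
     (fun w : g_sigma_algebraType (family_events F E) => X w 0 c)) ->
  observable_rV F E X.
Proof.
move=> KX mX c; split => //; have [B [_ KB]] := compact_bounded K_compact.
exists (`|B| + 1) => w; rewrite (le_trans (coord_le_norm _ _))// KB//.
by rewrite ltr_pwDr// ler_norm.
Qed.

(** Bounded because [X] is, by the Lipschitz condition. *)
Lemma lipschitz_observable E (g : 'rV[R]_d -> R) C X : 0 <= C ->
  (forall x y, K x -> K y -> g x - g y <= C * `|x - y|) ->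
  (forall w, K (X w)) -> observable_rV F E X -> observable F E (g \o X).
Proof.
move=> C0 lip KX oX; split.
  apply: (@measurable_lipschitz_comp _ _ _ (g_sigma_algebraType (family_events F E))
    K (fun x _ => g x) C) => //.
    by move=> x y _; exact: lip.
  by move=> c; case: (oX c).
have [_ [B XB]] := bmeas_norm oX; pose x0 := X point.
have KX0 : K x0 by exact: KX.
exists (`|g x0| + C * (B + B)) => w.
have dist : C * `|X w - x0| <= C * (B + B).
  rewrite ler_wpM2l// (le_trans (ler_normB _ _))// lerD//.
    by have := XB w; rewrite normr_id.
  by have := XB point; rewrite normr_id.
have up := lip _ _ (KX w) KX0; have := lip _ _ KX0 (KX w); rewrite distrC => low.
have -> : (g \o X) w = g x0 + (g (X w) - g x0) by rewrite /= addrC subrK.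
rewrite (le_trans (ler_normD _ _))// lerD2l.
by rewrite ler_norml; apply/andP; split; lra.
Qed.

Lemma gradient_observable E X : (forall w, K (X w)) -> observable_rV F E X ->
  observable_rV F E (fun w => grad f (X w)).
Proof.
move=> KX oX c; apply: (lipschitz_observable (g := fun x => grad f x 0 c)
  (C := L * d%:R)) oX => //; first by rewrite mulr_ge0// ltW.
move=> x y Kx Ky; rewrite -rV_subE (le_trans (ler_norm _))//.
rewrite (le_trans (coord_le_enorm _ _))//.
rewrite (le_trans (proj2 (problem_smooth L_gt0 problem) _ _ Kx Ky))//.
by rewrite -mulrA ler_pM2l// enorm_le_norm.
Qed.

Lemma objective_observable E X : (forall w, K (X w)) -> observable_rV F E X ->
  observable F E (fun w => f (X w)).
Proof.
move=> KX oX.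
have Ginf_ge0 : 0 <= Ginf.
  exact: le_trans (grad_bounded problem point (KX point)).
apply: (lipschitz_observable (C := d%:R * Ginf * d%:R)) oX => //.
  by rewrite !mulr_ge0.
move=> x y Kx Ky; have := problem_gradient_lower L_gt0 problem Kx Ky.
have gx : enorm (grad f x) <= d%:R * Ginf.
  rewrite (le_trans (enorm_le_norm _))// ler_wpM2l//; apply: norm_leP => // c.
  exact: gradient_coord_le problem _ _ Kx.
have : dot (grad f x) (x - y) <= d%:R * Ginf * (d%:R * `|x - y|).
  rewrite (le_trans (cauchy_schwarz _ _))// ler_pM ?enorm_ge0//.
  exact: enorm_le_norm.
by rewrite !dotBr mulrA; lra.
Qed.

Lemma sample_law_mean t m j (h : q.-tuple R -> R) :
  \int[distribution Pr (z t m j)]_u h u = \int[P]_u h u.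
Proof.
rewrite /Rintegral; congr fine; apply: eq_measure_integral => A mA _.
exact: sample_law draws_iid t m j A mA.
Qed.

Section Sampling.
Variables (t : nat) (m : 'I_M) (j : nat) (X : Omega -> 'rV[R]_d).
Hypothesis X_in : forall w, K (X w).
Hypothesis X_past : observable_rV F (before t) X.

Let X_other : observable_rV F [set~ sample t m j] X.
Proof. by apply: observable_rV_sub X_past; exact: before_other. Qed.

Let sample_fresh : ~ [set~ sample t m j] (sample t m j).
Proof. by move=> /(_ erefl). Qed.

Let sampleE :
  F (sample t m j) = preimage_set_system setT (z t m j) measurable.
Proof. by []. Qed.

Let twoL_ge0 : 0 <= 2 * L * d%:R.
Proof. by rewrite !mulr_ge0// ltW. Qed.

(** The sampling noise at a past iterate has mean zero given all
    draws except the sample itself, including the other samples of the same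
    round. *)
Lemma noise_orthogonal c Y : observable F [set~ sample t m j] Y ->
  Ex (fun w => Y w * noise (X w) (z t m j w) 0 c) = 0.
Proof.
move=> oY; apply: (sample_mean_eq0
  (draw_events_measurable (z := z) (u1 := u1) (u2 := u2))
  (draw_events_setI (z := z) (u1 := u1) (u2 := u2))
  (draw_events_setT z u1 u2) (draws_independent draws_iid) sampleE sample_fresh
  (K := K) (chi := fun x u => noise x u 0 c)
  (C := 2 * L * d%:R) (B := 2 * Ginf) (X := X) K_compact twoL_ge0 _ _ _ X_in X_other oY).
- by move=> x Kx; have [] := bmeas_gradient_noise problem Kx c.
- by move=> x u; exact: gradient_noise_coord_le problem x u c.
- move=> x y u Kx Ky; rewrite (le_trans (ler_norm _))//.
  exact: (gradient_noise_lipschitz L_gt0 problem u c).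
- by move=> x Kx; rewrite sample_law_mean; exact: gradient_noise_mean_eq0 problem _ _ Kx.
Qed.

Lemma noise_variance : Ex (fun w =>
  dot (noise (X w) (z t m j w)) (noise (X w) (z t m j w))) <= sigma ^+ 2.
Proof.
have Ginf_ge0 : 0 <= Ginf.
  exact: le_trans (grad_bounded problem point (X_in point)).
apply: (sample_mean_le
  (draw_events_measurable (z := z) (u1 := u1) (u2 := u2))
  (draw_events_setI (z := z) (u1 := u1) (u2 := u2))
  (draw_events_setT z u1 u2) (draws_independent draws_iid) sampleE sample_fresh
  (K := K) (chi := fun x u => dot (noise x u) (noise x u))
  (C := d%:R * (2 * L * d%:R * (4 * Ginf))) (B := d%:R * (2 * Ginf) ^+ 2) (X := X)) => //.
- by rewrite !mulr_ge0// ltW.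
- move=> x Kx; have bx := bmeas_gradient_noise problem Kx.
  by have [] := bmeas_dot bx bx.
- by move=> x u; exact: sqr_gradient_noise_bounded problem x u.
- by move=> x y u; exact: (sqr_gradient_noise_lipschitz L_gt0 problem u).
- by move=> x Kx; rewrite sample_law_mean; exact: gradient_noise_variance problem _ Kx.
Qed.

Lemma sample_gradient_known :
  observable_rV F (before t `|` [set sample t m j])
    (fun w => Gt (X w) (z t m j w)).
Proof.
move=> c; apply: (sample_observable sampleE (E := before t)
  (K := K) (chi := fun x u => Gt x u 0 c) (C := L * d%:R) (B := Ginf) (X := X)) => //.
- by rewrite mulr_ge0// ltW.
- by move=> x Kx; exact: grad_measurable problem _ _ Kx.
- by move=> x u; exact: sample_gradient_coord_le problem x u c.
- move=> x y u Kx Ky; rewrite -rV_subE (le_trans (ler_norm _))//.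
  rewrite (le_trans (coord_le_enorm _ _))//.
  rewrite (le_trans (sample_gradient_lipschitz problem u Kx Ky))//.
  by rewrite -mulrA ler_pM2l// enorm_le_norm.
- by right.
Qed.

End Sampling.
End RandomIterates.

(** * The error of the estimate in a run *)

Lemma period_gt0 i : (0 < period i)%N.
Proof. by rewrite expn_gt0. Qed.

Lemma sum_period i : (0 < i)%N -> (\sum_(1 <= j < i) period j).+1 = period i.
Proof.
case: i => // i _; elim: i => [|i IHi]; first by rewrite big_geq.
by rewrite big_nat_recr //= -addSn IHi /period /= expnS mul2n addnn.
Qed.

(** Since the periods before i have total length p_i - 1, the step size 2 / (p_i + k)
    of round t is 2 / (t + 1), without reference to periods. *)
Lemma round_indexS i k : (0 < i)%N ->
  (round_index period i k).+1 = (period i + k)%N.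
Proof. by move=> i0; rewrite /round_index -addSn sum_period. Qed.

Lemma round_index_surj t : (0 < t)%N -> exists i k,
  [/\ (1 <= i)%N, (1 <= k <= period i)%N & round_index period i k = t].
Proof.
case: t => // t _; elim: t => [|t [i [k [i1 /andP[k1 kp] <-]]]].
  by exists 1%N, 1%N; split=> //; rewrite /round_index big_geq.
have [klt|] := ltnP k (period i).
  by exists i, k.+1; split=> //; rewrite /round_index addnS.
move=> pk; have kE : k = period i by apply/eqP; rewrite eqn_leq kp pk.
exists i.+1, 1%N; split; rewrite ?period_gt0//.
by rewrite /round_index big_nat_recr// kE addn1.
Qed.

Section Roundup.
Context {R : realType}.
Implicit Types y : R.

Lemma roundup_gt0 y : (0 < roundup y)%N.
Proof. by rewrite /roundup leq_max. Qed.

Lemma roundup_ge y : 0 <= y -> y <= (roundup y)%:R.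
Proof.
move=> y0; apply: (@le_trans _ _ `|Num.ceil y|%:R); last by rewrite ler_nat leq_maxr.
rewrite natr_absz ger0_norm; first exact: ceil_ge.
by rewrite ceil_ge0// (lt_le_trans _ y0)// ltrN10.
Qed.

Lemma roundup_sqrt_ge y : 0 <= y -> y <= (roundup (Num.sqrt y))%:R ^+ 2.
Proof.
move=> y0; rewrite -{1}(sqr_sqrtr y0) lerXn2r ?nnegrE ?sqrtr_ge0//.
exact/roundup_ge/sqrtr_ge0.
Qed.

End Roundup.

Section Run.
Context {R : realType} {d q M : nat} {dO} {Omega : measurableType dO}.
Variables (K : set 'rV[R]_d) (P : probability (q.-tuple R) R).
Variables (ft : 'rV[R]_d -> q.-tuple R -> R) (f : 'rV[R]_d -> R).
Variables (L D Ginf sigma : R) (Pr : probability Omega R).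
Variables (z : nat -> 'I_M -> nat -> {RV Pr >-> q.-tuple R})
  (u1 : nat -> 'I_M -> 'I_d -> {RV Pr >-> R}) (u2 : nat -> 'I_d -> {RV Pr >-> R}).
Variables (x gbar v : nat -> Omega -> 'rV[R]_d).
Hypotheses (M_gt0 : (0 < M)%N) (L_gt0 : 0 < L) (D_gt0 : 0 < D).
Hypothesis problem : stochastic_problem K P ft f L D Ginf sigma.
Hypothesis draws_iid : independent_draws z u1 u2 P.
Hypothesis run : qfw_run ft K period (sample_size M L D sigma) step_size
  (worker_level d M) (master_level d) z u1 u2 x gbar v.
Local Notation F := (draw_events z u1 u2).
Local Notation sample t m j := (inl (inl (t, m, (j : nat))) : draw M d).
Local Notation Ex Y := (\int[Pr]_w Y w).
Local Notation Gt x z := (grad (ft^~ z) x).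
Local Notation noise := (gradient_noise ft f).

Definition step_at (t : nat) : R := 2 / t.+1%:R.

Lemma step_sizeE i k : (0 < i)%N ->
  step_size i k = step_at (round_index period i k).
Proof. by move=> i0; rewrite /step_at round_indexS// natrD. Qed.

Lemma step_at_itv t : (0 < t)%N -> 0 <= step_at t <= 1.
Proof.
move=> t0; rewrite divr_ge0//= ler_pdivrMr ?ltr0n// mul1r ler_nat.
by rewrite ltnS.
Qed.

Lemma run_stepE t w : (0 < t)%N ->
  x t.+1 w = x t w + step_at t *: (v t w - x t w).
Proof.
move=> /round_index_surj[i [k [i1 ik <-]]].
by rewrite (run_step run i1 ik) step_sizeE.
Qed.

Lemma run_vertex t w : (0 < t)%N ->
  argmin K (fun y => dot y (gbar t w)) (v t w).
Proof.
move=> /round_index_surj[i [k [i1 ik <-]]]; exact: (run_oracle run i1 ik w).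
Qed.

Lemma run_in t w : (0 < t)%N -> K (x t w).
Proof.
case: t => // t _; elim: t => [|t IHt].
  by have [x1 Kx1 ->] := run_init run.
rewrite run_stepE//; apply: convex_set_segment => //.
- exact: domain_convex problem.
- by have [] := run_vertex w (ltn0Sn t).
- exact: step_at_itv.
Qed.

Lemma vertex_known t : (0 < t)%N -> observable_rV F (before t.+1) (v t).
Proof.
move=> t0; apply: (observable_rV_in problem).
  by move=> w; have [] := run_vertex w t0.
move=> c _ B mB; rewrite setTI; move: t0 => /round_index_surj[i [k [i1 ik <-]]].
have := run_adapted run i1 ik; move=> /(_ c B mB); exact.
Qed.

Lemma iterate_known t : (0 < t)%N -> observable_rV F (before t) (x t).
Proof.
case: t => // t _; elim: t => [|t IHt].
  have [x1 _ x1E] := run_init run.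
  by rewrite (_ : x 1%N = fun=> x1); [exact: bmeas_rV_cst|exact/funext].
rewrite (_ : x t.+2 = fun w => x t.+1 w + step_at t.+1 *: (v t.+1 w - x t.+1 w)); last first.
  by apply/funext => w; exact: run_stepE.
have IH := observable_rV_sub (before_sub (leqnSn t.+1)) IHt.
apply: bmeas_rVD => //; apply/bmeas_rVZ/bmeas_rVB => //.
exact: vertex_known.
Qed.

Lemma iterate_move t w : (0 < t)%N -> enorm (x t.+1 w - x t w) <= step_at t * D.
Proof.
move=> t0; have /andP[e0 _] := step_at_itv t0.
rewrite run_stepE// addrC addKr enormZ ger0_norm// ler_wpM2l//.
apply: (domain_distance_le problem); last exact: run_in.
by have [] := run_vertex w t0.
Qed.

Definition estimate_error t w := gbar t w - grad f (x t w).

Definition error_bound : R := 25 * (L * D) ^+ 2 + 2 * Ginf ^+ 2.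

Let roundM i k : (0 < M%:R * (roundup (sample_size M L D sigma i k))%:R :> R).
Proof. by rewrite mulr_gt0 ?ltr0n// roundup_gt0. Qed.

Lemma ratio_le_div (a b c e : R) : 0 < b -> 0 < e -> a * e <= c * b ->
  a / b <= c / e.
Proof. by move=> b0 e0; rewrite ler_pdivrMr// mulrAC ler_pdivlMr. Qed.

(** The sampling noise contributes at most (L D)^2 / p^2, and each of the two encodings
    at most Ginf^2 / p^2. *)
Lemma first_estimate i : (0 < i)%N -> let t := round_index period i 1 in
  observable_rV F (before t.+1) (estimate_error t) /\
  Ex (fun w => dot (estimate_error t w) (estimate_error t w)) <=
    ((L * D) ^+ 2 + 2 * Ginf ^+ 2) / (period i)%:R ^+ 2.
Proof.
move=> i0 t.
have p1 : (1 <= 1 <= period i)%N by rewrite period_gt0.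
have t0 : (0 < t)%N by rewrite /t /round_index addn1.
set n := roundup (sample_size M L D sigma i 1).
set s1 := roundup (worker_level d M i 1 : R).
set s2 := roundup (master_level d i 1 : R).
pose Z m j w := Gt (x t w) (z t m j w).
pose mu w := grad f (x t w).
have Kx w : K (x t w) by exact: run_in.
have ox := iterate_known t0.
have errE : estimate_error t =
    fun w => 0 + decoded u1 u2 t n s1 s2 Z w - mu w.
  apply/funext => w; rewrite add0r /estimate_error /mu.
  rewrite (run_estimate run i0 p1 w) /= /decoded; congr (quantize _ _ _ - _).
  rewrite /master_gradient /aggregate; congr (_ *: _); apply: eq_bigr => m _.
  congr quantize; exact: (batch_gradient problem n _ (Kx w)).
have omu : observable_rV F (before t) mu by exact: (gradient_observable L_gt0 problem Kx ox).
have oZ m j : observable_rV F (before t `|` [set sample t m j]) (Z m j).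
  exact: (sample_gradient_known L_gt0 problem m j Kx ox).
have o0 : observable_rV F (before t) (fun=> 0 : 'rV[R]_d) by exact: bmeas_rV_cst.
split.
  rewrite errE; apply: (round_error_known _ _ _ o0 omu oZ);
  exact: roundup_gt0.
rewrite errE; apply: le_trans (round_error_sqr draws_iid (v := sigma ^+ 2) (N := Ginf)
  M_gt0 _ _ _ o0 omu oZ _ _ _) _; rewrite ?roundup_gt0//.
- move=> m j c Y oY; rewrite -[RHS](noise_orthogonal L_gt0 problem draws_iid Kx ox c oY).
  by apply: eq_Rintegral => w _; rewrite /Z /mu rV_subE.
- move=> m j; exact: (noise_variance L_gt0 problem draws_iid _ _ Kx ox).
- by move=> m j w; exact: (grad_bounded problem (z t m j w) (Kx w)).
have M_pos : 0 < M%:R :> R by rewrite ltr0n.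
have p_pos : 0 < (period i)%:R :> R by rewrite ltr0n period_gt0.
have p2_pos : 0 < (period i)%:R ^+ 2 :> R by rewrite exprn_gt0.
have n_ge : sigma ^+ 2 * (period i)%:R ^+ 2 <= (L * D) ^+ 2 * (M%:R * n%:R).
  have : sample_size M L D sigma i 1 <= n%:R.
    apply: roundup_ge; rewrite /sample_size /=.
    by rewrite divr_ge0 ?(sqr_ge0, mulr_ge0).
  rewrite /sample_size /= ler_pdivrMr; last by rewrite !mulr_gt0 ?exprn_gt0.
  by move=> /le_trans; apply; apply: eqr_le; ring.
have s1_ge : d%:R * (period i)%:R ^+ 2 <= M%:R * s1%:R ^+ 2 :> R.
  rewrite [leRHS]mulrC -ler_pdivrMr//.
  by apply: roundup_sqrt_ge; rewrite divr_ge0 ?mulr_ge0 ?sqr_ge0.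
have s2_ge : d%:R * (period i)%:R ^+ 2 <= s2%:R ^+ 2 :> R.
  by apply: roundup_sqrt_ge; rewrite mulr_ge0 ?sqr_ge0.
have s1_pos : 0 < s1%:R :> R by rewrite ltr0n roundup_gt0.
have s2_pos : 0 < s2%:R :> R by rewrite ltr0n roundup_gt0.
under eq_Rintegral do rewrite dot0l.
rewrite mean_cst add0r.
have h1 : sigma ^+ 2 / (M%:R * n%:R) <= (L * D) ^+ 2 / (period i)%:R ^+ 2.
  by apply: ratio_le_div => //; exact: roundM.
have h2 : d%:R * Ginf ^+ 2 / (M%:R * s1%:R ^+ 2) <= Ginf ^+ 2 / (period i)%:R ^+ 2.
  apply: ratio_le_div; rewrite ?mulr_gt0 ?exprn_gt0//.
  by rewrite mulrAC mulrC ler_wpM2l ?sqr_ge0.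
have h3 : d%:R * Ginf ^+ 2 / s2%:R ^+ 2 <= Ginf ^+ 2 / (period i)%:R ^+ 2.
  apply: ratio_le_div; rewrite ?exprn_gt0//.
  by rewrite mulrAC mulrC ler_wpM2l ?sqr_ge0.
rewrite mulrDl mulr_natl mulr2n mulrDl; lra.
Qed.

(** The iterate has moved by at most 2 D / p, so N = 2 L D / p bounds all the sampled
    differences, and 2 N bounds their distance to the true difference.  The
    batches and levels then turn N^2 into (4 + 1 + 1) N^2 / p, which is
    24 (L D)^2 / p^3. *)
Lemma next_estimate i k (c : R) : (0 < i)%N -> (2 <= k <= period i)%N ->
  let t := round_index period i k in
  observable_rV F (before t) (estimate_error t.-1) ->
  Ex (fun w => dot (estimate_error t.-1 w) (estimate_error t.-1 w)) <= c ->
  observable_rV F (before t.+1) (estimate_error t) /\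
  Ex (fun w => dot (estimate_error t w) (estimate_error t w)) <=
    c + 24 * (L * D) ^+ 2 / (period i)%:R ^+ 3.
Proof.
move=> i0 /andP[k2 kp] t oW Wc.
have k1p : (1 <= k <= period i)%N by rewrite (ltnW k2).
have k1F : (k == 1)%N = false by rewrite gtn_eqF.
have [t' tE] : exists t', t = t'.+2.
  exists (t - 2)%N; rewrite -addn2 subnK//.
  exact: leq_trans k2 (leq_addl _ _).
have t0 : (0 < t)%N by rewrite tE.
have t10 : (0 < t.-1)%N by rewrite tE.
set n := roundup (sample_size M L D sigma i k).
set s1 := roundup (worker_level d M i k : R).
set s2 := roundup (master_level d i k : R).
pose Z m j w := Gt (x t w) (z t m j w) - Gt (x t.-1 w) (z t m j w).
pose mu w := grad f (x t w) - grad f (x t.-1 w).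
have Kx w : K (x t w) by exact: run_in.
have Kx' w : K (x t.-1 w) by exact: run_in.
have ox := iterate_known t0.
have ox' : observable_rV F (before t) (x t.-1).
  by apply: observable_rV_sub (iterate_known t10); apply: before_sub; rewrite leq_pred.
have errE : estimate_error t =
    fun w => estimate_error t.-1 w + decoded u1 u2 t n s1 s2 Z w - mu w.
  apply/funext => w; rewrite /estimate_error /mu.
  rewrite (run_estimate run i0 k1p w) k1F.
  have -> : decoded u1 u2 t n s1 s2 Z w = quantize s2 (fun c => u2 t c w)
      (master_gradient ft n s1 (fun m j => z t m j w) (fun m c => u1 t m c w) k
        (x t w) (x t.-1 w)).
    rewrite /decoded; congr (quantize _ _ _).
    rewrite /master_gradient /aggregate; congr (_ *: _); apply: eq_bigr => m _.
    congr quantize; rewrite /worker_gradient k1F !(batch_gradient problem)//.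
    by rewrite /batch_mean -scalerBr -sumrB.
  rewrite -/t -/n -/s1 -/s2; set Q := quantize _ _ _.
  by rewrite opprB [X in _ = X + _]addrAC addrA subrK [Q + _]addrC.
have omu : observable_rV F (before t) mu.
  apply: bmeas_rVB; first exact: (gradient_observable L_gt0 problem Kx ox).
  exact: (gradient_observable L_gt0 problem Kx' ox').
have oZ m j : observable_rV F (before t `|` [set sample t m j]) (Z m j).
  apply: bmeas_rVB; first exact: (sample_gradient_known L_gt0 problem m j Kx ox).
  exact: (sample_gradient_known L_gt0 problem m j Kx' ox').
split.
  by rewrite errE; apply: (round_error_known _ _ _ oW omu oZ); exact: roundup_gt0.
have p_pos : 0 < (period i)%:R :> R by rewrite ltr0n period_gt0.
have move_le w : enorm (x t w - x t.-1 w) <= 2 * D / (period i)%:R.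
  have -> : t = t.-1.+1 by rewrite tE.
  rewrite (le_trans (iterate_move w t10))// /step_at mulrAC ler_wpM2l//.
    by rewrite mulr_ge0// ltW.
  rewrite lef_pV2 ?posrE ?ltr0n ?period_gt0// ler_nat.
  have -> : t.-1.+1 = t by rewrite tE.
  by rewrite -ltnS /t round_indexS// -addn1 leq_add2l ltnW.
have Lmove w : L * enorm (x t w - x t.-1 w) <= 2 * (L * D) / (period i)%:R.
  by have := ler_wpM2l (ltW L_gt0) (move_le w); rewrite !mulrA (mulrC L 2).
set N := 2 * (L * D) / (period i)%:R in Lmove.
have N_ge0 : 0 <= N by rewrite divr_ge0 ?mulr_ge0// ltW.
have Z_le m j w : enorm (Z m j w) <= N.
  exact: le_trans (sample_gradient_lipschitz problem _ (Kx w) (Kx' w)) (Lmove w).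
have mu_le w : enorm (mu w) <= N.
  exact: le_trans (proj2 (problem_smooth L_gt0 problem) _ _ (Kx w) (Kx' w)) (Lmove w).
rewrite errE; apply: le_trans (round_error_sqr draws_iid (v := (2 * N) ^+ 2) (N := N)
  M_gt0 _ _ _ oW omu oZ _ _ _) _; rewrite ?roundup_gt0//.
- move=> m j c' Y oY.
  have bY := observable_bmeas (draw_events_measurable (z := z) (u1 := u1) (u2 := u2)) oY.
  have bnoise X : (forall w, K (X w)) -> observable_rV F (before t) X ->
      bounded_measurable (fun w => noise (X w) (z t m j w) 0 c').
    move=> KX oX; apply: bmeas_rVB.
      apply: observable_rV_bmeas (sample_gradient_known L_gt0 problem m j KX oX).
      exact: draw_events_measurable.
    apply: observable_rV_bmeas (gradient_observable L_gt0 problem KX oX).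
    exact: draw_events_measurable.
  have e1 := noise_orthogonal L_gt0 problem draws_iid Kx ox c' oY.
  have e2 := noise_orthogonal L_gt0 problem draws_iid Kx' ox' c' oY.
  (* The noise of a difference is the difference of two noises. *)
  transitivity (Ex (fun w => Y w * noise (x t w) (z t m j w) 0 c' -
                             Y w * noise (x t.-1 w) (z t m j w) 0 c')).
    apply: eq_Rintegral => w _; rewrite /Z /mu /gradient_noise !rV_subE; ring.
  rewrite meanB; [|by apply: bmeasM => //; exact: bnoise..].
  by rewrite e1 e2 subrr.
- move=> m j; rewrite -[leRHS](mean_cst Pr); apply: le_mean; [|exact: bmeas_cst|].
    have bZ : bounded_measurable_rV (fun w => Z m j w - mu w).
      apply: bmeas_rVB; [apply: observable_rV_bmeas (oZ m j)|apply: observable_rV_bmeas omu];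
      exact: draw_events_measurable.
    exact: bmeas_dot.
  move=> w; rewrite -enorm_sqr lerXn2r ?nnegrE ?enorm_ge0 ?(mulr_ge0 (ler0n _ 2) N_ge0)//.
  rewrite -scaleN1r (le_trans (enorm_triangle _ _))// enormZ normrN1 mul1r.
  by have := Z_le m j w; have := mu_le w; lra.
- by move=> m j w; exact: le_trans (norm_le_enorm _) (Z_le m j w).
have M_pos : 0 < M%:R :> R by rewrite ltr0n.
have n_ge : (period i)%:R <= M%:R * n%:R :> R.
  rewrite [leRHS]mulrC -ler_pdivrMr//.
  have : sample_size M L D sigma i k <= n%:R.
    by apply: roundup_ge; rewrite /sample_size k1F divr_ge0.
  by rewrite /sample_size k1F.
have s1_ge : d%:R * (period i)%:R <= M%:R * s1%:R ^+ 2 :> R.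
  rewrite [leRHS]mulrC -ler_pdivrMr//.
  by rewrite /s1 /worker_level k1F; apply: roundup_sqrt_ge; rewrite divr_ge0 ?mulr_ge0.
have s2_ge : d%:R * (period i)%:R <= s2%:R ^+ 2 :> R.
  by rewrite /s2 /master_level k1F; apply: roundup_sqrt_ge; rewrite mulr_ge0.
have s1_pos : 0 < s1%:R :> R by rewrite ltr0n roundup_gt0.
have s2_pos : 0 < s2%:R :> R by rewrite ltr0n roundup_gt0.
have h1 : (2 * N) ^+ 2 / (M%:R * n%:R) <= (2 * N) ^+ 2 / (period i)%:R.
  by apply: ratio_le_div; rewrite ?roundM// ler_wpM2l ?sqr_ge0.
have h2 : d%:R * N ^+ 2 / (M%:R * s1%:R ^+ 2) <= N ^+ 2 / (period i)%:R.
  apply: ratio_le_div; rewrite ?mulr_gt0 ?exprn_gt0//.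
  by rewrite mulrAC mulrC ler_wpM2l ?sqr_ge0.
have h3 : d%:R * N ^+ 2 / s2%:R ^+ 2 <= N ^+ 2 / (period i)%:R.
  apply: ratio_le_div; rewrite ?exprn_gt0//.
  by rewrite mulrAC mulrC ler_wpM2l ?sqr_ge0.
have -> : 24 * (L * D) ^+ 2 / (period i)%:R ^+ 3 =
    (2 * N) ^+ 2 / (period i)%:R + N ^+ 2 / (period i)%:R + N ^+ 2 / (period i)%:R.
  by rewrite /N; field; rewrite gt_eqF.
lra.
Qed.

Lemma estimate_error_in_period i k : (0 < i)%N -> (0 < k <= period i)%N ->
  let t := round_index period i k in
  observable_rV F (before t.+1) (estimate_error t) /\
  Ex (fun w => dot (estimate_error t w) (estimate_error t w)) <=
    ((L * D) ^+ 2 + 2 * Ginf ^+ 2) / (period i)%:R ^+ 2 +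
    k.-1%:R * (24 * (L * D) ^+ 2 / (period i)%:R ^+ 3).
Proof.
move=> i0; elim: k => // k IHk /andP[_ kp]; case: k IHk kp => [|k] IHk kp t.
  by rewrite mul0r addr0; exact: first_estimate.
have [oe le] := IHk (ltnW kp).
have tE : t.-1 = round_index period i k.+1 by rewrite /t /round_index addnS.
have tE1 : t = (round_index period i k.+1).+1 by rewrite /t /round_index addnS.
have oe0 : observable_rV F (before t) (estimate_error t.-1).
  by rewrite tE tE1; exact: oe.
have le0 : Ex (fun w => dot (estimate_error t.-1 w) (estimate_error t.-1 w)) <=
    ((L * D) ^+ 2 + 2 * Ginf ^+ 2) / (period i)%:R ^+ 2 +
    k%:R * (24 * (L * D) ^+ 2 / (period i)%:R ^+ 3).
  by rewrite tE; exact: le.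
have k2p : (2 <= k.+2 <= period i)%N by rewrite kp.
have [oe' le'] := next_estimate i0 k2p oe0 le0.
split => //; apply: le_trans le' _.
have -> : k.+2.-1%:R = k%:R + 1 :> R by rewrite natr1.
by rewrite -addrA lerD2l [in leRHS]mulrDl mul1r.
Qed.

Lemma estimate_error_known t : (0 < t)%N ->
  observable_rV F (before t.+1) (estimate_error t).
Proof.
by move=> /round_index_surj[i [k [i1 ik <-]]]; case: (estimate_error_in_period i1 ik).
Qed.

Lemma estimate_error_sqr i k : (0 < i)%N -> (0 < k <= period i)%N ->
  Ex (fun w => dot (estimate_error (round_index period i k) w)
                   (estimate_error (round_index period i k) w)) <=
    error_bound / (period i)%:R ^+ 2.
Proof.
move=> i0 ik; have [_ le] := estimate_error_in_period i0 ik.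
apply: le_trans le _.
have p_pos : 0 < (period i)%:R :> R by rewrite ltr0n period_gt0.
have kp : k.-1%:R <= (period i)%:R :> R.
  by rewrite ler_nat; case/andP: ik => _; apply: leq_trans; exact: leq_pred.
have -> : error_bound / (period i)%:R ^+ 2 =
    ((L * D) ^+ 2 + 2 * Ginf ^+ 2) / (period i)%:R ^+ 2 +
    (period i)%:R * (24 * (L * D) ^+ 2 / (period i)%:R ^+ 3).
  by rewrite /error_bound; field; rewrite gt_eqF.
by rewrite lerD2l ler_wpM2r// divr_ge0 ?mulr_ge0 ?exprn_ge0// ltW ?mulr_gt0.
Qed.

End Run.

(** * Complexity and convergence *)

Lemma sum_sqr_period n :
  (\sum_(1 <= i < n.+2) period i ^ 2 <= 4 * period n.+1 ^ 2)%N.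
Proof.
elim: n => [|n IHn]; first by rewrite big_nat1.
rewrite big_nat_recr//=.
have -> : period n.+2 = (2 * period n.+1)%N by rewrite /period /= expnS.
rewrite expnMn; apply: leq_trans (leq_add IHn (leqnn _)) _.
by rewrite -mulnDl mulnA leq_pmul2r// expn_gt0 period_gt0.
Qed.

(** A period of length p begins in round p, so the condition selects the periods
    that begin by round T.  In this geometric sum the last term dominates. *)
Lemma sum_sqr_period_le n T :
  (\sum_(1 <= i < n.+1 | period i <= T) period i ^ 2 <= 4 * T ^ 2)%N.
Proof.
elim: n => [|n IHn]; first by rewrite big_geq.
have [pT|pT] := leqP (period n.+1) T; last first.
  have pF : (period n.+1 <= T)%N = false by rewrite leqNgt pT.
  by rewrite big_mkcond big_nat_recr//= pF addn0 -big_mkcond.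
apply: (@leq_trans (\sum_(1 <= i < n.+2) period i ^ 2)).
  rewrite big_mkcond; apply: leq_sum => i _; by case: ifP.
by apply: leq_trans (sum_sqr_period n) _; rewrite leq_pmul2l// leq_exp2r.
Qed.

Section SFO.
Context {R : realType}.
Variables (M : nat) (L D sigma : R) (T : nat).
Hypotheses (M_gt0 : (0 < M)%N) (L_gt0 : 0 < L) (D_gt0 : 0 < D).

Let rate : R := sigma ^+ 2 / (L ^+ 2 * D ^+ 2) + 2.

Lemma period_sfo i : (0 < i)%N ->
  \sum_(1 <= k < (period i).+1 | (round_index period i k <= T)%N)
     (if k == 1%N then 1 else 2) * sample_size M L D sigma i k <=
  if (period i <= T)%N then rate / M%:R * (period i)%:R ^+ 2 else 0.
Proof.
move=> i0; have M_pos : 0 < M%:R :> R by rewrite ltr0n.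
have first_ge0 : 0 <= sigma ^+ 2 * (period i)%:R ^+ 2 / (M%:R * L ^+ 2 * D ^+ 2).
  by rewrite divr_ge0 ?(sqr_ge0, mulr_ge0).
case: leqP => [_|Tp]; last first.
  rewrite big_nat_cond big1// => k /andP[/andP[k1 _] kT].
  have : ((round_index period i k).+1 <= T.+1)%N by [].
  by rewrite round_indexS// leqNgt => /negP[]; rewrite -[T.+2]addn1 leq_add.
set A := _ / _ in first_ge0.
apply: (@le_trans _ _ (\sum_(1 <= k < (period i).+1)
    ((if k == 1%N then A else 0) + 2 * ((period i)%:R / M%:R)))).
  rewrite big_mkcond; apply: ler_sum => k _.
  have B0 : 0 <= 2 * ((period i)%:R / M%:R) :> R by rewrite mulr_ge0 ?divr_ge0.
  rewrite /sample_size; case: (k == 1%N); case: ifP => _.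
  - by rewrite mul1r lerDl.
  - by rewrite addr_ge0.
  - by rewrite add0r.
  - by rewrite add0r.
rewrite big_split/= sumr_const_nat subn1 /= big_ltn ?ltnS ?period_gt0// eqxx.
rewrite big_nat big1 ?addr0; last by move=> k /andP[k2 _]; rewrite gtn_eqF.
rewrite -[_ *+ _]mulr_natr /A /rate le_eqVlt; apply/orP; left; apply/eqP; field.
by rewrite !gt_eqF.
Qed.

Lemma sfo_complexity_le :
  sfo_complexity period (sample_size M L D sigma) T <=
  rate / M%:R * (4 * T%:R ^+ 2).
Proof.
have rate_ge0 : 0 <= rate by rewrite addr_ge0// divr_ge0 ?(sqr_ge0, mulr_ge0).
apply: (@le_trans _ _ (\sum_(1 <= i < T.+1)
    if (period i <= T)%N then rate / M%:R * (period i)%:R ^+ 2 else 0)).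
  by apply: ler_sum_nat => i /andP[i1 _]; exact: period_sfo.
rewrite -big_mkcond -mulr_sumr ler_wpM2l//; first by rewrite divr_ge0.
under eq_bigr do rewrite -natrX.
by rewrite -natr_sum -natrX -natrM ler_nat sum_sqr_period_le.
Qed.

End SFO.

Section Convergence.
Context {R : realType} {d q M : nat} {dO} {Omega : measurableType dO}.
Variables (K : set 'rV[R]_d) (P : probability (q.-tuple R) R).
Variables (ft : 'rV[R]_d -> q.-tuple R -> R) (f : 'rV[R]_d -> R).
Variables (L D Ginf sigma : R) (Pr : probability Omega R).
Variables (z : nat -> 'I_M -> nat -> {RV Pr >-> q.-tuple R})
  (u1 : nat -> 'I_M -> 'I_d -> {RV Pr >-> R}) (u2 : nat -> 'I_d -> {RV Pr >-> R}).
Variables (x gbar v : nat -> Omega -> 'rV[R]_d).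
Hypotheses (M_gt0 : (0 < M)%N) (L_gt0 : 0 < L) (D_gt0 : 0 < D).
Hypothesis problem : stochastic_problem K P ft f L D Ginf sigma.
Hypothesis draws_iid : independent_draws z u1 u2 P.
Hypothesis run : qfw_run ft K period (sample_size M L D sigma) step_size
  (worker_level d M) (master_level d) z u1 u2 x gbar v.
Variable xmin : 'rV[R]_d.
Hypothesis xminP : argmin K f xmin.
Local Notation F := (draw_events z u1 u2).
Local Notation Ex Y := (\int[Pr]_w Y w).
Local Notation e := (estimate_error f x gbar).

Definition gap t w := f (x t w) - f xmin.

(** The vertex is optimal for gbar instead of the gradient, which costs the inner
    product of the error with xmin - v, at most D |e|.  For any C > 0 this is at
    most D / 2 (C |e|^2 + 1 / C), so that only second moments of e are needed. *)
Lemma frank_wolfe_step t w (C : R) : (0 < t)%N -> 0 < C ->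
  gap t.+1 w <= (1 - step_at t) * gap t w +
    step_at t * (D / 2 * (C * dot (e t w) (e t w) + C^-1)) +
    L * (step_at t * D) ^+ 2.
Proof.
move=> t0 C0; have /andP[h0 h1] := step_at_itv (R := R) t0.
have Kx := run_in problem run w t0; have Kx1 := run_in problem run w (ltn0Sn t).
have [Kv v_min] := run_vertex run w t0; have [Kmin _] := xminP.
have up := smooth_upper (domain_convex problem) (problem_smooth L_gt0 problem)
  (ltW L_gt0) Kx Kx1.
have move2 : enorm (x t.+1 w - x t w) ^+ 2 <= (step_at t * D) ^+ 2.
  rewrite lerXn2r ?nnegrE ?enorm_ge0 ?mulr_ge0// ?(ltW D_gt0)//.
  exact: (iterate_move problem run).
have dir : x t.+1 w - x t w = step_at t *: (v t w - x t w).
  by rewrite (run_stepE run)// addrC addKr.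
have lin : dot (grad f (x t w)) (v t w - x t w) <=
    - gap t w + dot (e t w) (xmin - v t w).
  have low := problem_gradient_lower L_gt0 problem Kx Kmin.
  have := v_min xmin Kmin; rewrite -/(gap t w) /= !(dotC _ (gbar t w)).
  move: low; rewrite /gap /e !dotBl !dotBr; lra.
have err : dot (e t w) (xmin - v t w) <=
    D / 2 * (C * dot (e t w) (e t w) + C^-1).
  rewrite (le_trans (cauchy_schwarz _ _))// -enorm_sqr.
  have dist := domain_distance_le problem Kmin Kv.
  apply: (@le_trans _ _ (enorm (e t w) * D)); first by rewrite ler_wpM2l ?enorm_ge0.
  set a := enorm (e t w).
  (* Complete the square. *)
  have -> : D / 2 * (C * a ^+ 2 + C^-1) =
      a * D + D / (2 * C) * (C * a - 1) ^+ 2 by field; rewrite gt_eqF.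
  by rewrite lerDl mulr_ge0 ?sqr_ge0// divr_ge0 ?mulr_ge0// ltW.
have step : step_at t * dot (grad f (x t w)) (v t w - x t w) <=
    step_at t * (- gap t w + D / 2 * (C * dot (e t w) (e t w) + C^-1)).
  by rewrite ler_wpM2l// (le_trans lin)// lerD2l.
have quad : L * enorm (x t.+1 w - x t w) ^+ 2 <= L * (step_at t * D) ^+ 2.
  by rewrite ler_pM2l.
move: up quad step; rewrite dir dotZr /gap; set X := _ * dot _ _; lra.
Qed.

Definition gap_rate : R := 4 * D * Num.sqrt (error_bound L D Ginf) + 4 * L * D ^+ 2.

Lemma error_bound_gt0 : 0 < error_bound L D Ginf.
Proof.
apply: ltr_wpDr; first by rewrite mulr_ge0 ?sqr_ge0.
by rewrite mulr_gt0// exprn_gt0// mulr_gt0.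
Qed.

Lemma gap_known t : (0 < t)%N -> bounded_measurable (gap t).
Proof.
move=> t0; apply: bmeasB; last exact: bmeas_cst.
apply: (observable_bmeas (draw_events_measurable (z := z) (u1 := u1) (u2 := u2))).
apply: (objective_observable L_gt0 problem _ (iterate_known problem run t0)).
by move=> w; exact: (run_in problem run).
Qed.

(** The choice C = p / sqrt error_bound balances the two terms
    of the bound on D |e|; both become D sqrt error_bound / (2 p), and p is at
    least (t + 1) / 2. *)
Lemma mean_gap_step t : (0 < t)%N ->
  Ex (gap t.+1) <= (1 - step_at t) * Ex (gap t) + gap_rate / t.+1%:R ^+ 2.
Proof.
move=> t0; have [i [k [i1 ik tE]]] := round_index_surj t0.
have p_pos : 0 < (period i)%:R :> R by rewrite ltr0n period_gt0.
set c := Num.sqrt (error_bound L D Ginf).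
have c_gt0 : 0 < c by rewrite sqrtr_gt0 error_bound_gt0.
have C_gt0 : 0 < (period i)%:R / c by rewrite divr_gt0.
have be : bounded_measurable_rV (e t).
  apply: (observable_rV_bmeas (draw_events_measurable (z := z) (u1 := u1) (u2 := u2))).
  exact: (estimate_error_known M_gt0 L_gt0 D_gt0 problem draws_iid run t0).
have bee := bmeas_dot be be.
have bg := gap_known t0.
have /andP[step_ge0 _] := step_at_itv (R := R) t0.
pose A := step_at t * (D / 2) * ((period i)%:R / c).
pose B := step_at t * (D / 2) * (c / (period i)%:R) + L * (step_at t * D) ^+ 2.
have A_ge0 : 0 <= A.
  by rewrite mulr_ge0 ?(mulr_ge0 step_ge0) ?divr_ge0 ?(ltW D_gt0) ?(ltW c_gt0).
have le_step : Ex (gap t.+1) <=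
    (1 - step_at t) * Ex (gap t) + A * Ex (fun w => dot (e t w) (e t w)) + B.
  have bA := bmeasZ A bee; have bG := bmeasZ (1 - step_at t) bg.
  rewrite -!meanZ// -meanD// -[B](mean_cst Pr) -meanD//; last exact: bmeas_cst.
  2: exact: bmeasD.
  apply: le_mean; [exact: gap_known|by apply: bmeasD; [exact: bmeasD|exact: bmeas_cst]|].
  move=> w; apply: le_trans (frank_wolfe_step w t0 C_gt0) _.
  apply: eqr_le; rewrite /A /B; field.
  by rewrite !gt_eqF.
apply: (le_trans le_step); rewrite -addrA lerD2l.
have le_err : A * Ex (fun w => dot (e t w) (e t w)) <=
    A * (c ^+ 2 / (period i)%:R ^+ 2).
  rewrite ler_wpM2l// sqr_sqrtr ?(ltW error_bound_gt0)// -tE.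
  exact: (estimate_error_sqr M_gt0 L_gt0 D_gt0 problem draws_iid run i1 ik).
apply: (@le_trans _ _ (step_at t * D * (c / (period i)%:R) + L * (step_at t * D) ^+ 2)).
  apply: (le_trans (lerD le_err (lexx B))).
  apply: eqr_le; rewrite /A /B; field.
  by rewrite !gt_eqF.
have cp : c / (period i)%:R <= c * step_at t.
  rewrite ler_pM2l// /step_at -[X in X <= _]mul1r ler_pdivrMr// mulrAC ler_pdivlMr ?ltr0n//.
  rewrite mul1r -natrM ler_nat -tE round_indexS// mul2n -addnn leq_add2l.
  by case/andP: ik.
apply: (@le_trans _ _ (step_at t * D * (c * step_at t) + L * (step_at t * D) ^+ 2)).
  by rewrite lerD2r ler_wpM2l// mulr_ge0// ltW.
apply: eqr_le; rewrite /gap_rate -/c /step_at.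
have : t.+1%:R != 0 :> R by rewrite pnatr_eq0.
by move: (t.+1%:R : R) => n n0; field.
Qed.

Lemma mean_gap_le t : (0 < t)%N -> Ex (gap t.+1) <= gap_rate / t.+1%:R.
Proof.
have rate_ge0 : 0 <= gap_rate.
  by rewrite /gap_rate addr_ge0 ?mulr_ge0 ?sqrtr_ge0 ?sqr_ge0// ltW.
case: t => // t _; elim: t => [|t IHt]; apply: le_trans (mean_gap_step _) _ => //.
  (* The first step has length 1, so the initial gap is forgotten. *)
  rewrite /step_at divff// subrr mul0r add0r expr2 invfM mulrA.
  by rewrite ler_piMr ?divr_ge0// invf_le1 ?ler1n.
have n_pos : 0 < t.+2%:R :> R by rewrite ltr0n.
have s_pos : 0 < t.+3%:R :> R by rewrite ltr0n.
have /andP[_ h1] := step_at_itv (R := R) (ltn0Sn t.+1).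
apply: (@le_trans _ _ ((1 - step_at t.+2) * (gap_rate / t.+2%:R) + gap_rate / t.+3%:R ^+ 2)).
  by rewrite lerD2r ler_wpM2l// subr_ge0.
rewrite /step_at -[t.+3%:R]natr1; set n : R := t.+2%:R in n_pos *.
have n1_pos : 0 < n + 1 by rewrite addr_gt0.
rewrite -subr_ge0.
have -> : gap_rate / (n + 1) - ((1 - 2 / (n + 1)) * (gap_rate / n) + gap_rate / (n + 1) ^+ 2)
   = gap_rate / (n * (n + 1) ^+ 2) by field; rewrite !gt_eqF.
by rewrite divr_ge0// mulr_ge0 ?sqr_ge0// ltW.
Qed.

Lemma run_suboptimal t (eps : R) : (0 < t)%N -> gap_rate / t.+1%:R <= eps ->
  suboptimal Pr K f eps (x t.+1).
Proof.
move=> t0 rate_eps; exists xmin => //; rewrite unlock.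
have bf : bounded_measurable (fun w => f (x t.+1 w)).
  apply: (observable_bmeas (draw_events_measurable (z := z) (u1 := u1) (u2 := u2))).
  apply: (objective_observable L_gt0 problem _ (iterate_known problem run (ltn0Sn t))).
  by move=> w; exact: (run_in problem run).
rewrite EFin_mean// -EFinB lee_fin; apply: le_trans rate_eps.
apply: le_trans (mean_gap_le t0); rewrite /gap meanB//; last exact: bmeas_cst.
by rewrite mean_cst.
Qed.

End Convergence.

Theorem corollary4p3p2 (R : realType) (L D Ginf sigma : R)
    (L_gt0 : 0 < L) (D_gt0 : 0 < D) :
  exists (C1 C2 eps0 : R) (T : R -> nat),
    [/\ 0 < C1, 0 < C2 & 0 < eps0] /\
    forall eps : R, 0 < eps <= eps0 ->
      (T eps)%:R <= C1 / eps /\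
      forall M : nat, (0 < M)%N ->
        sfo_complexity period (sample_size M L D sigma) (T eps)
          <= C2 / (M%:R * eps ^+ 2) /\
        forall (d q : nat) (K : set 'rV[R]_d) (P : probability (q.-tuple R) R)
          (ft : 'rV[R]_d -> q.-tuple R -> R) (f : 'rV[R]_d -> R),
          stochastic_problem K P ft f L D Ginf sigma ->
        forall (dO : measure_display) (Omega : measurableType dO)
          (Pr : probability Omega R)
          (z : nat -> 'I_M -> nat -> {RV Pr >-> q.-tuple R})
          (u1 : nat -> 'I_M -> 'I_d -> {RV Pr >-> R})
          (u2 : nat -> 'I_d -> {RV Pr >-> R})
          (x gbar v : nat -> Omega -> 'rV[R]_d),
          independent_draws z u1 u2 P ->
          qfw_run ft K period (sample_size M L D sigma) step_size
            (worker_level d M) (master_level d) z u1 u2 x gbar v ->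
          suboptimal Pr K f eps (x (T eps).+1).
Proof.
pose B : R := gap_rate L D Ginf.
have B_gt0 : 0 < B.
  rewrite /B /gap_rate ltr_wpDl ?mulr_gt0 ?exprn_gt0//.
  by rewrite !mulr_ge0 ?sqrtr_ge0// ltW.
pose rate : R := sigma ^+ 2 / (L ^+ 2 * D ^+ 2) + 2.
have rate_gt0 : 0 < rate.
  by rewrite /rate ltr_wpDl// divr_ge0 ?(sqr_ge0, mulr_ge0).
exists B, (rate * (4 * B ^+ 2)), B, (fun eps => Num.truncn (B / eps)).
split; first by split; rewrite // !mulr_gt0// exprn_gt0.
move=> eps /andP[eps_gt0 eps_le].
have /andP[T_le T_gt] := truncn_itv (divr_ge0 (ltW B_gt0) (ltW eps_gt0)).
have T_gt0 : (0 < Num.truncn (B / eps))%N.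
  by rewrite truncn_gt0 ler_pdivlMr// mul1r.
set T := Num.truncn _ in T_le T_gt T_gt0 *.
split=> // M M_gt0; split.
  apply: le_trans (sfo_complexity_le sigma T M_gt0 L_gt0 D_gt0) _.
  have T2 : T%:R ^+ 2 <= (B / eps) ^+ 2.
    by rewrite lerXn2r ?nnegrE ?divr_ge0 ?(ltW B_gt0) ?(ltW eps_gt0).
  apply: (@le_trans _ _ (rate / M%:R * (4 * (B / eps) ^+ 2))).
    by rewrite ler_wpM2l ?divr_ge0 ?(ltW rate_gt0)// ler_wpM2l.
  apply: eqr_le; field.
  by rewrite !gt_eqF ?ltr0n.
move=> d q K P ft f problem dO Omega Pr z u1 u2 x gbar v draws_iid run.
have [x1 Kx1 _] := run_init run.
have [xmin xminP] := problem_minimizer problem Kx1.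
apply: (run_suboptimal M_gt0 L_gt0 D_gt0 problem draws_iid run xminP T_gt0).
rewrite -/B ler_pdivrMr ?ltr0n// mulrC -ler_pdivrMr//.
exact: ltW.
Qed.
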